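(* Let $q>2$ and let $T$ be an $\omega$-Calder\'on--Zygmund operator on $\mathbb{R}^n$ with $\omega\in\mathrm{Dini}$. Then $\mathcal{V}_q\circ\mathcal{T}$ is a $\mathbb{B}_q$-valued bounded oscillation operator with respect to $\mathscr{B}$ and $r\in(1,q]$, with constants $\mathfrak{C}_1(\mathcal{V}_q\circ\mathcal{T})\le C\,C_K$ and $\mathfrak{C}_2(\mathcal{V}_q\circ\mathcal{T})\le C'(1+\|\omega\|_{\mathrm{Dini}})$, where $C$ is independent of $T$ and $C'$ may depend on $C_K$ but not otherwise on $T$ or $\omega$, and $\mathscr{B}$ is the collection of all cubes in $\mathbb{R}^n$.
   Context: $\omega:[0,\infty)\to[0,\infty)$ is a modulus of continuity (increasing, subadditive, $\omega(0)=0$); $\omega\in\mathrm{Dini}$ if $\|\omega\|_{\mathrm{Dini}}:=\int_0^1\omega(t)\frac{dt}t<\infty$. An $\omega$-Calder\'on--Zygmund operator $T$ on $\mathbb{R}^n$ is a linear operator, bounded on $L^{p}(\mathbb{R}^n)$ for some $p\in(1,\infty)$, with $Tf(x)=\int K(x,y)f(y)\,dy$ for $x\notin\operatorname{supp}f$ and $f$ H\''older continuous of bounded support, where the kernel $K$ on $\{x\ne y\}$ satisfies, with a constant $C_K>0$: $|K(x,y)|\le\frac{C_K}{|x-y|^n}$; $|K(x,y)-K(x',y)|\le\frac{C_K}{|x-y|^n}\omega(\frac{|x-x'|}{|x-y|})$ if $|x-x'|\le\frac12|x-y|$; $|K(x,y)-K(x,y')|\le\frac{C_K}{|x-y|^n}\omega(\frac{|y-y'|}{|x-y|})$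 if $|y-y'|\le\frac12|x-y|$. $q$-variation. For $\mathbf{a}=\{a_\eta\}_{\eta>0}$, $\|\mathbf{a}\|_{\mathbb{B}_q}:=\sup(\sum_{j=0}^\infty|a_{\eta_j}-a_{\eta_{j+1}}|^q)^{1/q}$, the supremum over all positive sequences $\{\eta_j\}$ decreasing to zero; $\mathbb{B}_q$ denotes the Banach space of families with finite norm modulo constant families. Put $T_\eta f(x):=\int_{|x-y|>\eta}K(x,y)f(y)\,dy$, $\mathcal{T}f(x):=\{T_\eta f(x)\}_{\eta>0}$, $(\mathcal{V}_q\circ\mathcal{T})f(x)=\mathcal{V}_q(\mathcal{T}f)(x):=\|\mathcal{T}f(x)\|_{\mathbb{B}_q}$. $\mathbb{R}^n$ carries Lebesgue measure and $\mathscr{B}$ is a ball-basis with $Q^*:=5Q$. Let $\langle f\rangle_{Q,r}:=(\frac1{|Q|}\int_Q|f|^r)^{1/r}$, $\lfloor f\rfloor_{Q,r}:=\sup_{Q'\in\mathscr{B},Q'\supset Q}\langle f\rangle_{Q',r}$. $\mathcal{V}_q\circ\mathcal{T}$ is a $\mathbb{B}_q$-valued bounded oscillation operator with respect to $\mathscr{B}$ and $r$, with constants $\mathfrak{C}_1,\mathfrak{C}_2\in(0,\infty)$, if: (T1) for every $Q_0\in\mathscr{B}$ there is $Q\in\mathscr{B}$, $Q\supsetneq Q_0$, such that for all $f\in L^r(\mathbb{R}^n)$, $\sup_{x\in Q_0}\|\mathcal{T}(f\mathbf{1}_{Q^*})(x)-\mathcal{T}(f\mathbf{1}_{Q_0^*})(x)\|_{\mathbb{B}_q}\le\mathfrak{C}_1\langle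 f\rangle_{Q^*,r}$; (T2) for every $Q\in\mathscr{B}$ and such $f$, $\sup_{x,x'\in Q}\|(\mathcal{T}f-\mathcal{T}(f\mathbf{1}_{Q^*}))(x)-(\mathcal{T}f-\mathcal{T}(f\mathbf{1}_{Q^*}))(x')\|_{\mathbb{B}_q}\le\mathfrak{C}_2\lfloor f\rfloor_{Q,r}$. *)

(* Defs.v *)
From HB Require Import structures.
From mathcomp Require Import all_boot all_order all_algebra.
From mathcomp Require Import complex.
From mathcomp Require Import all_classical all_reals all_analysis.

Set Implicit Arguments.
Unset Strict Implicit.
Unset Printing Implicit Defensive.
Import Order.TTheory GRing.Theory Num.Theory.
Import numFieldNormedType.Exports.

Local Open Scope classical_set_scope.
Local Open Scope ring_scope.

Section lebesgue_cons.
Context {R : realType} {n : nat}.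
Variable mu : {sigma_finite_measure set (n.-tuple R) -> \bar R}.

Definition cons_pair (p : measurableTypeR R * n.-tuple R) : n.+1.-tuple R :=
  [the n.+1.-tuple R of p.1 :: p.2].

Let measurable_cons_pair : measurable_fun setT cons_pair.
Proof. exact: (@measurable_cons _ _ _ R fst n snd). Qed.

HB.instance Definition _ :=
  isMeasurableFun.Build _ _ _ _ cons_pair measurable_cons_pair.

Definition lebesgue_cons : set (n.+1.-tuple R) -> \bar R :=
  pushforward (@lebesgue_measure R \x mu)%E cons_pair.

Let lebesgue_cons0 : lebesgue_cons set0 = 0%E.
Proof. exact: measure0. Qed.

Let lebesgue_cons_ge0 A : (0 <= lebesgue_cons A)%E.
Proof. exact: measure_ge0. Qed.

Let lebesgue_cons_sigma_additive : semi_sigma_additive lebesgue_cons.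
Proof. exact: measure_semi_sigma_additive. Qed.

HB.instance Definition _ := isMeasure.Build _ _ _ lebesgue_cons
  lebesgue_cons0 lebesgue_cons_ge0 lebesgue_cons_sigma_additive.

Lemma lebesgue_consE (A : set R) (B : set (n.-tuple R)) :
  measurable A -> measurable B ->
  lebesgue_cons [set x | A (thead x) /\ B [tuple of behead x]] =
  (lebesgue_measure A * mu B)%E.
Proof.
move=> mA mB; rewrite -product_measure1E//.
rewrite /lebesgue_cons /pushforward; congr (product_measure1 _ _ _).
apply/seteqP; split=> -[a t] /=; rewrite theadE.
  by move=> [? Bt]; split => //; move: Bt; congr B; exact/val_inj.
by move=> [? Bt]; split => //; move: Bt; congr B; exact/val_inj.
Qed.

Let lebesgue_cons_sigma_finite : sigma_finite setT lebesgue_cons.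
Proof.
have /sigma_finiteP[F [TF ndF Foo]] := sigma_finiteT (@lebesgue_measure R).
have /sigma_finiteP[G [TG ndG Goo]] := sigma_finiteT mu.
exists (fun k => [set x | F k (thead x) /\ G k [tuple of behead x]]).
  apply/seteqP; split=> // x _.
  have [i _ Fi] : (\bigcup_i F i) (thead x) by rewrite -TF.
  have [j _ Gj] : (\bigcup_i G i) [tuple of behead x] by rewrite -TG.
  exists (maxn i j) => //; split.
    by move: Fi; exact/subsetPset/ndF/leq_maxl.
  by move: Gj; exact/subsetPset/ndG/leq_maxr.
move=> k; have [mF Fk] := Foo k; have [mG Gk] := Goo k; split; last first.
  by rewrite lebesgue_consE// lte_mul_pinfty// ge0_fin_numE.
apply: measurableI.
- rewrite -[X in measurable X]setTI.
  exact: (measurable_tnth ord0).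
- rewrite -[X in measurable X]setTI.
  exact: measurable_behead.
Qed.

HB.instance Definition _ := Measure_isSigmaFinite.Build _ _ _ lebesgue_cons
  lebesgue_cons_sigma_finite.

End lebesgue_cons.
(* Lebesgue measure on R^n, seen as the type n.-tuple R with its product (Borel)
   sigma-algebra: the n-fold product of the one-dimensional one. *)
Fixpoint lebesgue_tuple (R : realType) (n : nat) :
    {sigma_finite_measure set (n.-tuple R) -> \bar R} :=
  match n with
  | 0 => \d_([tuple] : 0.-tuple R)
  | n'.+1 => lebesgue_cons (lebesgue_tuple R n')
  end.

Lemma lebesgue_tuple_prod (R : realType) (n : nat) (A : 'I_n -> set R) :
  (forall i, measurable (A i)) ->
  lebesgue_tuple R n [set x | forall i, A i (tnth x i)] =
  (\prod_(i < n) lebesgue_measure (A i))%E.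
Proof.
elim: n A => [|n IHn] A mA.
  rewrite big_ord0 /= diracE mem_set//= => -[].
  by [].
rewrite big_ord_recl -IHn//= -lebesgue_consE//; last first.
  rewrite [X in measurable X](_ : _ =
      \bigcap_(i in [set: 'I_n]) (@tnth n R ^~ i @^-1` A (lift ord0 i))).
    apply: fin_bigcap_measurable => // i _; rewrite -[X in measurable X]setTI.
    exact: measurable_tnth.
  by apply/seteqP; split=> [x /= Ax i _|x /= Ax i]; exact: Ax.
congr (lebesgue_cons _ _); apply/seteqP; split=> x /= Ax.
  split; first exact: (Ax ord0).
  by move=> i; have := Ax (lift ord0 i); rewrite [in X in X -> _](tuple_eta x) tnthS.
move=> i; case: (unliftP ord0 i) => [j ->|->]; last exact: Ax.1.
by rewrite (tuple_eta x) tnthS; exact: Ax.2.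
Qed.

Section euclidean_space.
Context {R : realType} {n : nat}.
Implicit Types (x y c : n.-tuple R) (f g : n.-tuple R -> R[i]) (p q r : R).
Local Notation mu := (lebesgue_tuple R n).
Local Notation cmod := (@Normc.normc R).
Local Notation cRe := (@complex.Re R).
Local Notation cIm := (@complex.Im R).

Definition edist x y : R := Num.sqrt (\sum_(i < n) (tnth x i - tnth y i) ^+ 2).

(* Meaningful when f is absolutely integrable on D; Rintegral is total. *)
Definition cintegral (D : set (n.-tuple R)) f : R[i] :=
  ((\int[mu]_(y in D) cRe (f y)) +i*
   (\int[mu]_(y in D) cIm (f y)))%C.

Definition cmeasurable f :=
  measurable_fun setT (cRe \o f) /\ measurable_fun setT (cIm \o f).

Definition cLnorm p f : \bar R := ('N[mu]_p%:E [EFin \o (cmod \o f)])%E.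

(* The elements of L^p are represented by Borel functions. *)
Definition cLp p : set (n.-tuple R -> R[i]) :=
  [set f | cmeasurable f /\ (cLnorm p f < +oo)%E].

Definition supp f : set (n.-tuple R) :=
  [set x | forall e, 0 < e -> exists2 y, edist x y < e & f y != 0].

Definition bounded_support f := exists x r, supp f `<=` [set y | edist x y <= r].

Definition hoelder_continuous f := exists a C : R,
  [/\ 0 < a, a <= 1 & forall x y, cmod (f x - f y) <= C * edist x y `^ a].

Record modulus_of_continuity (omega : R -> R) : Prop := ModulusOfContinuity {
  modulus_ge0 : forall t, 0 <= t -> 0 <= omega t;
  modulus_le : forall s t, 0 <= s -> s <= t -> omega s <= omega t;
  modulus_subadditive :
    forall s t, 0 <= s -> 0 <= t -> omega (s + t) <= omega s + omega t;
  modulus0 : omega 0 = 0 }.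

Definition dini_norm (omega : R -> R) : \bar R :=
  (\int[@lebesgue_measure R]_(t in `]0%R, 1%R]) (omega t / t)%:E)%E.

(* K is only constrained off the diagonal. *)
Record CZ_kernel (omega : R -> R) (CK : R) (K : n.-tuple R -> n.-tuple R -> R[i]) :
    Prop := CZKernel {
  CZ_kernel_size : forall x y, x != y -> cmod (K x y) <= CK / edist x y ^+ n;
  CZ_kernel_regl : forall x x' y, x != y -> edist x x' <= 2^-1 * edist x y ->
    cmod (K x y - K x' y) <=
      CK / edist x y ^+ n * omega (edist x x' / edist x y);
  CZ_kernel_regr : forall x y y', x != y -> edist y y' <= 2^-1 * edist x y ->
    cmod (K x y - K x y') <=
      CK / edist x y ^+ n * omega (edist y y' / edist x y) }.

(* T acts on representatives, so that identities between elements of L^p hold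
   almost everywhere. *)
Definition linear_bounded_on_Lp (T : (n.-tuple R -> R[i]) -> n.-tuple R -> R[i]) p :=
  (forall (a : R[i]) f g, cLp p f -> cLp p g ->
    {ae mu, forall x, T (fun y => a * f y + g y) x = a * T f x + T g x}) /\
  exists M : R, forall f, cLp p f ->
    cLp p (T f) /\ (cLnorm p (T f) <= M%:E * cLnorm p f)%E.

Record CZ_operator (omega : R -> R) (CK : R) (K : n.-tuple R -> n.-tuple R -> R[i])
    (T : (n.-tuple R -> R[i]) -> n.-tuple R -> R[i]) : Prop := CZOperator {
  CZ_bounded : exists p, 1 < p /\ linear_bounded_on_Lp T p;
  CZ_CK_gt0 : 0 < CK;
  CZ_operator_kernel : CZ_kernel omega CK K;
  CZ_representation : forall f, hoelder_continuous f -> bounded_support f ->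
    {ae mu, forall x, ~ supp f x -> T f x = cintegral setT (fun y => K x y * f y)} }.

(* A family indexed by eta > 0 is a function on R, of which only the values at
   positive arguments matter; constant families have norm 0. Repeated terms of eta
   contribute 0, so strictly decreasing sequences would give the same supremum. *)
Definition variation_norm q (a : R -> R[i]) : \bar R :=
  ereal_sup
    [set ((\sum_(0 <= j <oo) (cmod (a (eta j) - a (eta j.+1)) `^ q)%:E) `^ q^-1)%E
    | eta in [set eta : R^nat | [/\ forall j, 0 < eta j,
                nonincreasing_seq eta & eta j @[j --> \oo] --> (0 : R)]]].

Definition truncations (K : n.-tuple R -> n.-tuple R -> R[i]) f x : R -> R[i] :=
  fun eta => cintegral [set y | eta < edist x y] (fun y => K x y * f y).

Definition average r (A : set (n.-tuple R)) f : \bar R :=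
  (((fine (mu A))^-1%:E * \int[mu]_(y in A) (cmod (f y) `^ r)%:E) `^ r^-1)%E.

Definition sup_average {I : Type} (B : I -> set (n.-tuple R)) r (i : I) f :
    \bar R :=
  ereal_sup [set average r (B j) f | j in [set j | B i `<=` B j]].

Definition cutoff (A : set (n.-tuple R)) f : n.-tuple R -> R[i] :=
  fun y => f y * \1_A y.

(* B is the family of sets Q and Bs the corresponding family of sets Q^*; N is
   the norm of the space V in which the operator S takes its values. *)
Definition bounded_oscillation {I : Type} (B Bs : I -> set (n.-tuple R)) r
    {V : zmodType} (N : V -> \bar R)
    (S : (n.-tuple R -> R[i]) -> n.-tuple R -> V) (c1 c2 : R) :=
  [/\ 0 < c1, 0 < c2,
    forall i0, exists i, B i0 `<` B i /\ forall f, cLp r f ->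
      (ereal_sup [set N (S (cutoff (Bs i) f) x - S (cutoff (Bs i0) f) x)%R
                 | x in B i0] <= c1%:E * average r (Bs i) f)%E
  & forall i f, cLp r f ->
      (ereal_sup [set N ((S f x - S (cutoff (Bs i) f) x) -
                         (S f x' - S (cutoff (Bs i) f) x'))%R
                 | x in B i & x' in B i] <= c2%:E * sup_average B r i f)%E].

Record cube := Cube {
  cube_center : n.-tuple R;
  cube_side : R;
  cube_side_gt0 : 0 < cube_side }.

Definition cube_set (Q : cube) : set (n.-tuple R) :=
  [set x | forall i, `|tnth x i - tnth (cube_center Q) i| <= cube_side Q / 2].

(* The concentric cube 5Q. *)
Definition cube_star (Q : cube) : set (n.-tuple R) :=
  [set x | forall i, `|tnth x i - tnth (cube_center Q) i| <= 5 * cube_side Q / 2].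

End euclidean_space.
Arguments cube : clear implicits.

(* Main.v *)
Require Import Defs.
From HB Require Import structures.
From mathcomp Require Import all_boot all_order all_algebra.
From mathcomp Require Import complex.
From mathcomp Require Import all_classical all_reals all_analysis.
From mathcomp Require Import measurable_realfun ring lra zify.

(** Both bounds rest on the description of an increment of the truncations as an
integral over a shell, an annulus of radii [eta j.+1] and [eta j].

For the first condition, the doubled cube of side [2 * l] is used: the difference of
the two cut-offs of [f] lives at distance at least [2 * l] from the points of the cube, where
the kernel is at most [CK / (2 * l) ^+ n]. The shells being disjoint, the sum of the
increments, and a fortiori the variation, is bounded by the integral of [|K| |f|], hence
by an average of [f] ([variation_truncations_le]).

For the second condition, let [x] and [x'] be points of a cube of side [l], and let [h] be
the part of [f] outside of the fivefold cube. The difference of two increments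
splits into two terms ([variation_oscillation_le]). The first one integrates
[(K x y - K x' y) * h y] over the shells around [x]; its sum over the shells is at most
the full integral, which is estimated on the dyadic dilates of the cube: the regularity
of the kernel gives the sum of the [omega (2 ^- k)], comparable with the Dini integral
([dini_sum_le]), apart from a number of scales depending only on [n] where the size
of the kernel is used instead ([kernel_difference_le]).

The second term integrates [K x' y * h y] over the symmetric differences of the shells
around [x] and around [x']. These are contained in annuli of width of order [l] around the
boundary spheres ([shell_sub]), so their measure is small compared with the volume of
the ball they bound ([lebesgue_annulus_le]). By Hoelder's inequality the r-th power of the
integral over one of them is at most the integral, over the same set, of
[|f| `^ r] times [l `^ eps * v `^ - (n + eps)], up to a constant, where [v] is the distance
to [x'] and [eps = (r - 1) / 2] ([thin_shell_le]). Those sets overlap at most twice, so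
the r-th powers can be summed, and the sum over dyadic dilates is a geometric series
([tail_integral_le]). This is where [r <= q] enters, through the inclusion of l^r in l^q.

It remains to see that all these integrals make sense: the Dini condition forces the
modulus to vanish at 0, so the kernel is continuous in [y] off the diagonal and
therefore measurable ([cmeasurable_offdiag]), and Young's inequality makes the
truncations absolutely convergent on L^r ([integral_kernel_lt_pinfty]). *)

Import Order.TTheory GRing.Theory Num.Theory.
Import numFieldNormedType.Exports.
Local Open Scope classical_set_scope.
Local Open Scope ring_scope.
Set Implicit Arguments.
Unset Strict Implicit.
Unset Printing Implicit Defensive.
Local Notation edist := Defs.edist.

(** * Power sums and the variation norm *)
Section power_sums.
Context {R : realType}.
Implicit Types (p q r B : R) (b : nat -> R).

(** The inclusion of l^p in l^q for [p <= q], with norm one: every term is at most [B],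
so [b j `^ q <= b j `^ p * B `^ (q - p)]. *)
Lemma sum_powR_le p q B b N : 0 < p -> p <= q -> 0 <= B -> (forall j, 0 <= b j) ->
  \sum_(j < N) b j `^ p <= B `^ p -> \sum_(j < N) b j `^ q <= B `^ q.
Proof.
move=> p0 pq B0 b0 H.
have q0 : 0 < q by exact: lt_le_trans pq.
have E (x : R) : x `^ q = x `^ p * x `^ (q - p).
  by rewrite -powRD ?subrKC// (gt_eqF q0).
rewrite E; apply: le_trans (ler_wpM2r (powR_ge0 _ _) H).
rewrite big_distrl/=; apply: ler_sum => j _; rewrite E.
apply: ler_wpM2l; first exact: powR_ge0.
apply: ge0_ler_powR; rewrite ?nnegrE ?subr_ge0//.
have : b j `^ p <= B `^ p.
  apply: le_trans H; rewrite (bigD1 j)//= lerDl.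
  by apply: sumr_ge0 => i _; exact: powR_ge0.
apply: contraTT; rewrite -!ltNge => Bb.
by apply: gt0_ltr_powR; rewrite ?nnegrE.
Qed.

Lemma powRD_le r (a b : R) : 0 <= r -> 0 <= a -> 0 <= b ->
  (a + b) `^ r <= 2 `^ r * (a `^ r + b `^ r).
Proof.
move=> r0 a0 b0.
wlog ab : a b a0 b0 / a <= b => [H|].
  by have [/ltW|] := ltP b a; [rewrite addrC [X in _ * X]addrC|]; exact: H.
apply: (@le_trans _ _ ((2 * b) `^ r)).
  by apply: ge0_ler_powR; rewrite ?nnegrE//; lra.
by rewrite powRM//; apply: ler_wpM2l; rewrite ?powR_ge0// lerDr powR_ge0.
Qed.

(** Increments that split into a part summable to the power one and a part summable
to the power [p] are summable to the power [q]. The crude constant 4 stands in for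
Minkowski's inequality. *)
Lemma sum_powRD_le p q (B C : R) (b c d : nat -> R) N :
  1 <= p -> p <= q -> 0 <= B -> 0 <= C ->
  (forall j, 0 <= b j) -> (forall j, 0 <= c j) -> (forall j, 0 <= d j) ->
  (forall j, d j <= b j + c j) ->
  \sum_(j < N) b j <= B -> \sum_(j < N) c j `^ p <= C `^ p ->
  \sum_(j < N) d j `^ q <= (4 * (B + C)) `^ q.
Proof.
move=> p1 pq B0 C0 b0 c0 d0 dbc HB HC.
have p0 : 0 < p by exact: lt_le_trans p1.
have q1 : 1 <= q by exact: le_trans pq.
have q0 : 0 < q by exact: lt_le_trans pq.
have HB' : \sum_(j < N) b j `^ q <= B `^ q.
  apply: (@sum_powR_le 1) => //.
  by rewrite powRr1//; under eq_bigr do rewrite powRr1//.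
have HC' := sum_powR_le p0 pq C0 c0 HC.
apply: (@le_trans _ _ (\sum_(j < N) 2 `^ q * (b j `^ q + c j `^ q))).
  apply: ler_sum => j _; apply: le_trans (powRD_le (ltW q0) (b0 j) (c0 j)).
  by apply: ge0_ler_powR; rewrite ?nnegrE ?addr_ge0// ltW.
rewrite -big_distrr/= big_split/=.
have le2 (x : R) : 0 <= x -> x <= B + C -> x `^ q <= (B + C) `^ q.
  by move=> x0 xBC; apply: ge0_ler_powR; rewrite ?nnegrE ?addr_ge0// ltW.
apply: (@le_trans _ _ (2 `^ q * (2 * (B + C) `^ q))).
  apply: ler_wpM2l; first exact: powR_ge0.
  rewrite mulr_natl mulr2n lerD//; [apply: le_trans HB' _|apply: le_trans HC' _];
  by apply: le2; rewrite ?lerDl ?lerDr.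
have -> : 4 * (B + C) = 2 * (2 * (B + C)) by ring.
rewrite powRM ?mulr_ge0 ?addr_ge0// powRM ?mulr_ge0 ?addr_ge0//.
apply: ler_wpM2l; first exact: powR_ge0.
apply: ler_wpM2r; first exact: powR_ge0.
by rewrite -[leLHS]powRr1//; apply: ler_powR => //; lra.
Qed.

End power_sums.

Section variation_bound.
Context {R : realType}.
Local Notation cmod := (@Normc.normc R).

Lemma normc_ge0 (z : R[i]) : 0 <= cmod z.
Proof. by case: z => a b; exact: sqrtr_ge0. Qed.

Lemma variation_norm_le (q Z : R) (a : R -> R[i]) : 0 < q -> 0 <= Z ->
  (forall eta : nat -> R, (forall j, 0 < eta j) -> nonincreasing_seq eta ->
    forall N, \sum_(j < N) cmod (a (eta j) - a (eta j.+1)) `^ q <= Z `^ q) ->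
  (variation_norm q a <= Z%:E)%E.
Proof.
move=> q0 Z0 H; apply: ge_ereal_sup => _ [eta [eta0 etan _] <-].
rewrite [leRHS](_ : _ = ((Z `^ q)%:E `^ q^-1)%E); last first.
  by rewrite poweR_EFin -powRrM divff ?gt_eqF// powRr1.
have ge0 (N : nat) : (0 <= \sum_(0 <= j < N)
    (cmod (a (eta j) - a (eta j.+1)) `^ q)%:E)%E.
  by apply: sume_ge0 => j _; rewrite lee_fin powR_ge0.
apply: gt0_ler_poweR.
- by rewrite invr_ge0 ltW.
- rewrite in_itv/= leey andbT; apply: nneseries_ge0 => j _ _.
  by rewrite lee_fin powR_ge0.
- by rewrite in_itv/= leey andbT lee_fin powR_ge0.
apply: lime_le.
  by apply: is_cvg_nneseries => j _ _; rewrite lee_fin powR_ge0.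
by apply: nearW => N; rewrite sumEFin lee_fin big_mkord; exact: H.
Qed.

End variation_bound.

(** * Integrals of nonnegative real functions *)
Section integrals.
Context d (T : measurableType d) (R : realType) (mu : {measure set T -> \bar R}).
Local Notation mf f := (measurable_fun setT (f : T -> R)).

Lemma le_integral_EFin (f g : T -> R) : (forall y, 0 <= f y) ->
  mf f -> mf g -> (forall y, f y <= g y) ->
  (\int[mu]_y (f y)%:E <= \int[mu]_y (g y)%:E)%E.
Proof.
move=> f0 mf mg fg; apply: ge0_le_integral => //.
- by move=> y _; rewrite lee_fin.
- exact/measurable_EFinP.
- exact/measurable_EFinP.
- by move=> y _; rewrite lee_fin.
Qed.

Lemma integral_EFinD (f g : T -> R) : (forall y, 0 <= f y) -> (forall y, 0 <= g y) ->
  mf f -> mf g ->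
  (\int[mu]_y (f y + g y)%:E = \int[mu]_y (f y)%:E + \int[mu]_y (g y)%:E)%E.
Proof.
move=> f0 g0 mf mg; under eq_integral do rewrite EFinD.
apply: ge0_integralD => //.
- by move=> y _; rewrite lee_fin.
- exact/measurable_EFinP.
- by move=> y _; rewrite lee_fin.
- exact/measurable_EFinP.
Qed.

Lemma integral_EFinZ (k : R) (f : T -> R) : 0 <= k -> (forall y, 0 <= f y) -> mf f ->
  (\int[mu]_y (k * f y)%:E = k%:E * \int[mu]_y (f y)%:E)%E.
Proof.
move=> k0 f0 mf; under eq_integral do rewrite EFinM.
apply: ge0_integralZl => //; last by move=> y _; rewrite lee_fin.
exact/measurable_EFinP.
Qed.

Lemma integral_EFin_sum (f : nat -> T -> R) N : (forall j y, 0 <= f j y) ->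
  (forall j, mf (f j)) ->
  (\int[mu]_y (\sum_(j < N) f j y)%:E = \sum_(j < N) \int[mu]_y (f j y)%:E)%E.
Proof.
move=> f0 mf; under eq_integral do rewrite -sumEFin.
apply: (@ge0_integral_sum _ _ _ mu setT measurableT _
  (fun (j : 'I_N) y => (f j y)%:E)) => //.
- by move=> j; exact/measurable_EFinP.
- by move=> j y _; rewrite lee_fin.
Qed.

(** Trades an integral over a small set [E] for an integral of the r-th power, with
the gain [mu E `^ (r - 1)]: Hoelder's inequality for [g * \1_E] against [\1_E]. *)
Lemma hoelder_indic (r m : R) (E : set T) (g : T -> R) : 1 < r -> 0 <= m ->
  measurable E -> (mu E <= m%:E)%E -> mf g -> (forall y, 0 <= g y) ->
  ((\int[mu]_y (g y * \1_E y)%:E) `^ r <=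
   (m `^ (r - 1))%:E * \int[mu]_y (g y `^ r * \1_E y)%:E)%E.
Proof.
move=> r1 m0 mE Em mg g0.
have r0 : 0 < r by lra.
have r10 : 0 < r - 1 by rewrite subr_gt0.
pose r' := r / (r - 1).
have r'0 : 0 < r' by rewrite divr_gt0.
have mgE : mf (fun y => g y * \1_E y).
  by apply: measurable_funM => //; exact: measurable_indic.
have := @hoelder _ _ _ mu (fun y => g y * \1_E y) (\1_E) r r' mgE
  (@measurable_indic _ _ R setT E mE) r0 r'0.
have -> : r^-1 + r'^-1 = 1 by rewrite /r'; field; rewrite !gt_eqF.
move=> /(_ erefl).
have -> : ('N[mu]_1[EFin \o ((fun y => g y * \1_E y) \* \1_E)%R] =
    \int[mu]_y (g y * \1_E y)%:E)%E.
  rewrite Lnorm1; apply: eq_integral => y _ /=.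
  rewrite ger0_norm ?mulr_ge0// -mulrA; congr (_ * _)%:E.
  by rewrite indicE; case: (_ \in _); rewrite ?mulr1 ?mulr0.
move=> H; apply: (@le_trans _ _ (('N[mu]_r%:E[EFin \o (fun y => g y * \1_E y)%R] *
     'N[mu]_r'%:E[EFin \o \1_E])%E `^ r)%E).
  apply: gt0_ler_poweR => //; first exact: ltW.
    rewrite in_itv/= leey andbT.
    by apply: integral_ge0 => y _; rewrite lee_fin mulr_ge0.
  by rewrite in_itv/= leey andbT mule_ge0 ?Lnorm_ge0.
rewrite poweRM ?Lnorm_ge0// muleC.
rewrite (_ : (_ `^ r)%E = (('N[mu]_r'%:E[EFin \o \1_E] `^ r') `^ (r - 1))%E); last first.
  by rewrite -poweRrM; congr (poweR _ _); rewrite /r' divfK// gt_eqF.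
rewrite !poweR_Lnorm ?gt_eqF//.
apply: lee_pmul; rewrite ?poweR_ge0//.
- by apply: integral_ge0 => y _; exact: poweR_ge0.
- rewrite -poweR_EFin; apply: gt0_ler_poweR; first exact: ltW.
  + rewrite in_itv/= leey andbT.
    by apply: integral_ge0 => y _; rewrite lee_fin powR_ge0.
  + by rewrite in_itv/= leey andbT.
  + apply: le_trans Em; rewrite -[E in leRHS]setIT -integral_indic//.
    rewrite le_eqVlt; apply/orP; left; apply/eqP; apply: eq_integral => y _.
    by rewrite /= indicE; case: (_ \in _);
      rewrite ?normr1 ?powR1 ?normr0 ?powR0 ?gt_eqF.
- rewrite le_eqVlt; apply/orP; left; apply/eqP; apply: eq_integral => y _.
  by rewrite /= indicE; case: (_ \in _);
    rewrite ?mulr1 ?mulr0 ?ger0_norm ?normr0 ?powR0 ?gt_eqF.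
Qed.

End integrals.

(** * Euclidean distance, cubes and annuli *)
Section euclidean_distance.
Context {R : realType} {n : nat}.
Implicit Types x y z : n.-tuple R.

Lemma edist_ge0 x y : 0 <= edist x y.
Proof. exact: sqrtr_ge0. Qed.

Lemma edistC x y : edist x y = edist y x.
Proof. by congr Num.sqrt; apply: eq_bigr => i _; ring. Qed.

Lemma edistxx x : edist x x = 0.
Proof.
by rewrite /edist big1 ?sqrtr0// => i _; rewrite subrr expr0n.
Qed.

Lemma sqr_edist x y : edist x y ^+ 2 = \sum_(i < n) (tnth x i - tnth y i) ^+ 2.
Proof. by rewrite sqr_sqrtr// sumr_ge0// => i _; exact: sqr_ge0. Qed.

Lemma coord_le_edist x y i : `|tnth x i - tnth y i| <= edist x y.
Proof.
rewrite -sqrtr_sqr; apply: ler_wsqrtr; rewrite (bigD1 i)//= lerDl.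
by apply: sumr_ge0 => j _; exact: sqr_ge0.
Qed.

Lemma edist_le_coord x y (s : R) : 0 <= s ->
  (forall i, `|tnth x i - tnth y i| <= s) -> edist x y <= n%:R * s.
Proof.
move=> s0 H; rewrite -(@ler_pXn2r _ 2)// ?nnegrE ?edist_ge0 ?mulr_ge0//.
rewrite sqr_edist; apply: (@le_trans _ _ (\sum_(i < n) s ^+ 2)).
  apply: ler_sum => i _; rewrite -real_normK ?num_real//.
  by rewrite ler_pXn2r ?nnegrE.
rewrite sumr_const card_ord -[_ *+ n]mulr_natl exprMn.
apply: ler_wpM2r; first exact: sqr_ge0.
by case: n => [|m]; rewrite ?expr0n// expr2 ler_peMl ?ler1n// ler0n.
Qed.

Lemma edist_gt0 x y : x != y -> 0 < edist x y.
Proof.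
move=> xy; rewrite lt_neqAle edist_ge0 andbT; apply: contra xy => /eqP xy0.
apply/eqP/eq_from_tnth => i; apply/eqP; rewrite -subr_eq0 -normr_le0 xy0.
exact: coord_le_edist.
Qed.

(** With [A] and [B] the two norms, expand [0 <= \sum_i (B * a i - A * b i) ^+ 2]. *)
Lemma cauchy_schwarz (a b : 'I_n -> R) :
  \sum_i a i * b i <=
  Num.sqrt (\sum_i a i ^+ 2) * Num.sqrt (\sum_i b i ^+ 2).
Proof.
set sa := \sum_i a i ^+ 2; set sb := \sum_i b i ^+ 2.
have sa0 : 0 <= sa by apply: sumr_ge0 => i _; exact: sqr_ge0.
have sb0 : 0 <= sb by apply: sumr_ge0 => i _; exact: sqr_ge0.
have vanish (u : 'I_n -> R) : \sum_i u i ^+ 2 <= 0 -> forall i, u i = 0.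
  move=> u0 i; apply/eqP; rewrite -sqrf_eq0 eq_le sqr_ge0 andbT.
  by apply: le_trans u0; rewrite (bigD1 i)//= lerDl sumr_ge0// => j _; exact: sqr_ge0.
have [/vanish a0|sa1] := leP sa 0.
  by rewrite big1 ?mulr_ge0 ?sqrtr_ge0// => i _; rewrite a0 mul0r.
have [/vanish b0|sb1] := leP sb 0.
  by rewrite big1 ?mulr_ge0 ?sqrtr_ge0// => i _; rewrite b0 mulr0.
set A := Num.sqrt sa; set B := Num.sqrt sb.
have A0 : 0 < A by rewrite sqrtr_gt0.
have B0 : 0 < B by rewrite sqrtr_gt0.
have : 0 <= \sum_i (B * a i - A * b i) ^+ 2 by apply: sumr_ge0 => i _; exact: sqr_ge0.
have -> : \sum_i (B * a i - A * b i) ^+ 2 = 2 * (A * B) * (A * B - \sum_i a i * b i).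
  under eq_bigr => i _ do rewrite sqrrB !exprMn.
  rewrite big_split/= sumrB -!big_distrr/= -/sa -/sb.
  rewrite (_ : \sum_i B * a i * (A * b i) *+ 2 = 2 * (A * B) * \sum_i a i * b i).
    by rewrite -(sqr_sqrtr sa0) -(sqr_sqrtr sb0) -/A -/B; ring.
  by rewrite big_distrr/=; apply: eq_bigr => i _; ring.
by rewrite pmulr_rge0 ?subr_ge0// !mulr_gt0.
Qed.

Lemma edist_triangle y x z : edist x z <= edist x y + edist y z.
Proof.
rewrite -(@ler_pXn2r _ 2)// ?nnegrE ?addr_ge0 ?edist_ge0//.
rewrite sqrrD !sqr_edist.
rewrite (eq_bigr (fun i => (tnth x i - tnth y i) ^+ 2 +
   (tnth x i - tnth y i) * (tnth y i - tnth z i) *+ 2 +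
   (tnth y i - tnth z i) ^+ 2)); last by move=> i _; ring.
rewrite big_split big_split /= lerD2r lerD2l sumrMnl lerMn2r/=.
exact: cauchy_schwarz.
Qed.

Lemma edist_lipschitz x x' y : `|edist x y - edist x' y| <= edist x x'.
Proof.
rewrite ler_norml; apply/andP; split.
  by rewrite lerNl opprB lerBlDr (edistC x x') edist_triangle.
by rewrite lerBlDr edist_triangle.
Qed.

Lemma measurable_edist x : measurable_fun setT (edist x).
Proof.
apply: (@measurableT_comp _ _ _ _ _ _ (@Num.sqrt R)).
  apply: nondecreasing_measurable => //; exact: ler_wsqrtr.
apply: measurable_sum => i; apply: measurable_funX; apply: measurable_funB => //.
exact: measurable_tnth.
Qed.

Lemma measurable_edist_powR x (a : R) : measurable_fun setT (fun y => edist x y `^ a).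
Proof. by apply: (measurableT_comp (measurable_powR _)); exact: measurable_edist. Qed.

Lemma measurable_edist_exprV x (k : nat) :
  measurable_fun setT (fun y => (edist x y ^+ k)^-1).
Proof.
under eq_fun do rewrite -powR_mulrn ?edist_ge0// -powRN.
exact: measurable_edist_powR.
Qed.

Lemma measurable_edist_gt x (s : R) : measurable [set y | s < edist x y].
Proof.
rewrite -[X in measurable X]setTI (_ : [set y | _] = edist x @^-1` `]s, +oo[).
  exact: measurable_edist.
by apply/seteqP; split => y /=; rewrite in_itv/= andbT.
Qed.

End euclidean_distance.

Section boxes.
Context {R : realType} {n : nat}.
Implicit Types c : n.-tuple R.

Definition box c (s : R) : set (n.-tuple R) :=
  [set x | forall i, `|tnth x i - tnth c i| <= s / 2].

Lemma boxE c s : box c s =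
  [set x | forall i, `[tnth c i - s / 2, tnth c i + s / 2]%classic (tnth x i)].
Proof.
by apply/seteqP; split => x /= H i; move: (H i);
  rewrite in_itv/= ler_distl.
Qed.

Lemma measurable_box c s : measurable (box c s).
Proof.
rewrite boxE [X in measurable X](_ : _ = \bigcap_(i in [set: 'I_n])
    (@tnth n R ^~ i @^-1` `[tnth c i - s / 2, tnth c i + s / 2]%classic)).
  apply: fin_bigcap_measurable => // i _; rewrite -[X in measurable X]setTI.
  exact: measurable_tnth.
by apply/seteqP; split=> [x /= Ax i _|x /= Ax i]; exact: Ax.
Qed.

Lemma lebesgue_box c (s : R) : 0 <= s -> lebesgue_tuple R n (box c s) = (s ^+ n)%:E.
Proof.
move=> s0; rewrite boxE.
rewrite (lebesgue_tuple_prod (A := fun i => `[tnth c i - s / 2, tnth c i + s / 2]%classic))//.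
rewrite (eq_bigr (fun=> s%:E)).
  by rewrite big_const card_ord; elim: n => //= m ->; rewrite -EFinM -exprS.
move=> i _; rewrite lebesgue_measure_itv/= lte_fin.
have [|] := ltP; first by move=> _; rewrite -EFinD; congr EFin; field.
by rewrite lerD2l => h; congr EFin; lra.
Qed.

Lemma subset_box c (s t : R) : s <= t -> box c s `<=` box c t.
Proof. by move=> st x H i; apply: le_trans (H i) _; lra. Qed.

End boxes.

Section annulus.
Context {R : realType}.

(** The set consists of two intervals of length [sqrt b - sqrt a <= sqrt (b - a)]. *)
Lemma lebesgue_sqr_annulus (c a b : R) :
  (@lebesgue_measure R [set t | (a <= (t - c) ^+ 2 <= b)%R] <=
   (2 * Num.sqrt (b - a))%:E)%E.
Proof.
have [b0|b0] := ltP b 0.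
  rewrite (_ : [set t | _] = set0) ?measure0 ?lee_fin ?mulr_ge0 ?sqrtr_ge0//.
  by apply/seteqP; split => // t /= /andP[_ h]; move: (sqr_ge0 (t - c)); lra.
have [ba|ab] := ltP b a.
  rewrite (_ : [set t | _] = set0) ?measure0 ?lee_fin ?mulr_ge0 ?sqrtr_ge0//.
  by apply/seteqP; split => // t /= /andP[? ?]; lra.
pose al : R := Num.sqrt a; pose be : R := Num.sqrt b.
have al0 : 0 <= al by exact: sqrtr_ge0.
have be0 : 0 <= be by exact: sqrtr_ge0.
have albe : al <= be by exact: ler_wsqrtr.
have be2 : be ^+ 2 = b by rewrite sqr_sqrtr.
have al2 : a <= al ^+ 2.
  have [a0|a0] := leP 0 a; first by rewrite sqr_sqrtr.
  by apply: le_trans (sqr_ge0 _); exact: ltW.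
have len : be - al <= Num.sqrt (b - a).
  rewrite -(@ler_pXn2r _ 2)// ?nnegrE ?sqrtr_ge0 ?subr_ge0//.
  rewrite sqr_sqrtr ?subr_ge0//.
  have [a0|a0] := leP 0 a; last by rewrite /al ltr0_sqrtr// subr0 be2; lra.
  have al2E : al ^+ 2 = a by rewrite sqr_sqrtr.
  by rewrite -be2 -al2E; have : 0 <= al * (be - al); [rewrite mulr_ge0// subr_ge0|nra].
have sub : [set t | (a <= (t - c) ^+ 2 <= b)%R] `<=`
    `[c - be, c - al]%classic `|` `[c + al, c + be]%classic.
  move=> t /= /andP[at2 tb].
  have h : al <= `|t - c| <= be.
    by rewrite -sqrtr_sqr /al /be !ler_wsqrtr.
  move: h; rewrite !in_itv/=; case: (ger0P (t - c)) => tc /andP[h1 h2].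
    by right; apply/andP; split; lra.
  by left; apply/andP; split; lra.
apply: (@le_trans _ _ (@lebesgue_measure R
    (`[c - be, c - al]%classic `|` `[c + al, c + be]%classic))).
  apply: le_measure => //; rewrite inE; last exact: measurableU.
  rewrite (_ : [set t | _] = setT `&` (fun t => (t - c) ^+ 2) @^-1` `[a, b]); last first.
    by rewrite setTI; apply/seteqP; split => t /=; rewrite in_itv.
  have : measurable_fun setT (fun t : R => (t - c) ^+ 2).
    by apply: measurable_funX; exact: measurable_funB.
  exact.
apply: le_trans (measureU2 (@lebesgue_measure R) (measurable_itv _) (measurable_itv _)) _.
have -> : 2 * Num.sqrt (b - a) = Num.sqrt (b - a) + Num.sqrt (b - a) by ring.
have itv_le (u v : R) : v - u <= Num.sqrt (b - a) ->
    (@lebesgue_measure R `[u, v]%classic <= (Num.sqrt (b - a))%:E)%E.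
  move=> uv; rewrite lebesgue_measure_itv/= lte_fin.
  by case: ifP => _; rewrite ?EFinN -?EFinB lee_fin// sqrtr_ge0.
rewrite EFinD; apply: leeD; apply: itv_le; lra.
Qed.

(** Slicing by lines parallel to the first axis: every slice has length at most
[4 * sqrt (D * (s + D))] by [lebesgue_sqr_annulus], and only the slices over a cube
of side [2 * (s + D)] meet the annulus. The exact order of magnitude is
[D * s ^+ m]; a bound with any positive power of [D / s] in front of the volume of the
ball is enough to make the oscillation estimate converge, and this one needs
neither polar coordinates nor the scaling of the measure. *)
Lemma lebesgue_annulus_le (m : nat) (x : m.+1.-tuple R) (s D : R) :
  0 <= s -> 0 <= D ->
  (lebesgue_tuple R m.+1 [set y | (s - D <= edist x y <= s + D)%R] <=
   ((2 * (s + D)) ^+ m * (4 * Num.sqrt (D * (s + D))))%:E)%E.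
Proof.
move=> s0 D0; set A := [set y | _].
have mA : measurable A.
  rewrite (_ : A = setT `&` edist x @^-1` `[s - D, s + D]).
    exact: measurable_edist.
  by rewrite setTI; apply/seteqP; split => t /=; rewrite in_itv.
set P := (@cons_pair R m) @^-1` A.
have mP : measurable P.
  by rewrite -[P]setTI; apply: (@measurable_cons _ _ _ R fst m snd).
pose x0 := thead x; pose x' : m.-tuple R := [tuple of behead x].
pose a := Num.max 0 (s - D); pose b := s + D.
have slice (y : m.-tuple R) : (@lebesgue_measure R (ysection P y) <=
    (4 * Num.sqrt (D * (s + D)) * \1_(box x' (2 * b)) y)%:E)%E.
  pose rho2 := \sum_(i < m) (tnth x' i - tnth y i) ^+ 2.
  have distE t : edist x (cons_pair (t, y)) ^+ 2 = (t - x0) ^+ 2 + rho2.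
    rewrite sqr_edist big_ord_recl; congr (_ + _).
      by rewrite -sqrrN opprB.
    apply: eq_bigr => i _; congr ((_ - _) ^+ 2).
    - by rewrite [in LHS](tuple_eta x) tnthS.
    - by rewrite !(tnth_nth 0).
  have [yb|yb] := pselect (box x' (2 * b) y); last first.
    rewrite indicE memNset// mulr0 (_ : ysection P y = set0) ?measure0//.
    apply/seteqP; split => // t; rewrite /ysection/= inE /P/A/= => /andP[_ h].
    apply: yb => i; rewrite distrC -sqrtr_sqr.
    apply: (@le_trans _ _ (edist x (cons_pair (t, y)))); last first.
      by apply: le_trans h _; rewrite /b; lra.
    rewrite -[leRHS](ger0_norm (edist_ge0 _ _)) -sqrtr_sqr; apply: ler_wsqrtr.
    rewrite distE; apply: (@le_trans _ _ rho2); last by rewrite lerDr sqr_ge0.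
    by rewrite /rho2 (bigD1 i)//= lerDl sumr_ge0// => j _; exact: sqr_ge0.
  rewrite indicE mem_set// mulr1.
  have sub : ysection P y `<=` [set t | (a ^+ 2 - rho2 <= (t - x0) ^+ 2 <= b ^+ 2 - rho2)%R].
    move=> t; rewrite /ysection/= inE /P/A/= => /andP[h1 h2].
    rewrite lerBlDr lerBrDr -distE; apply/andP; split.
      rewrite ler_pXn2r ?nnegrE ?edist_ge0//; last by rewrite le_max lexx.
      by rewrite ge_max edist_ge0.
    by rewrite ler_pXn2r ?nnegrE ?edist_ge0// addr_ge0.
  apply: (@le_trans _ _ (@lebesgue_measure R
      [set t | (a ^+ 2 - rho2 <= (t - x0) ^+ 2 <= b ^+ 2 - rho2)%R])).
    apply: le_measure => //; rewrite inE; first exact: measurable_ysection.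
    rewrite (_ : [set t | _] = setT `&` (fun t => (t - x0) ^+ 2) @^-1`
        `[a ^+ 2 - rho2, b ^+ 2 - rho2]); last first.
      by rewrite setTI; apply/seteqP; split => t /=; rewrite in_itv.
    have : measurable_fun setT (fun t : R => (t - x0) ^+ 2).
      by apply: measurable_funX; exact: measurable_funB.
    exact.
  apply: le_trans (lebesgue_sqr_annulus _ _ _) _.
  rewrite lee_fin (_ : 4 = 2 * 2); last by ring.
  rewrite -mulrA ler_pM2l//.
  have -> : 2 * Num.sqrt (D * (s + D)) = Num.sqrt (4 * (D * (s + D))).
    rewrite [in RHS]sqrtrM//; congr (_ * _).
    by rewrite (_ : 4 = 2 ^+ 2) ?sqrtr_sqr ?ger0_norm//; ring.
  apply: ler_wsqrtr; rewrite /a /b.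
  by have [sD|sD] := leP (s - D) 0; nra.
rewrite /=/lebesgue_cons/pushforward -/P.
rewrite (@product_measure_unique _ _ _ _ _ (@lebesgue_measure R) (lebesgue_tuple R m)
  (@lebesgue_measure R \x^ lebesgue_tuple R m)%E)//; last first.
  by move=> X Y mX mY; apply: product_measure2E.
rewrite /product_measure2.
apply: (@le_trans _ _ (\int[lebesgue_tuple R m]_y
    (4 * Num.sqrt (D * (s + D)) * \1_(box x' (2 * b)) y)%:E)%E).
  apply: ge0_le_integral => //.
  - exact: measurable_fun_ysection.
  - apply/measurable_EFinP; apply: measurable_funM => //.
    by apply: measurable_indic; exact: measurable_box.
  by move=> y _; exact: slice.
rewrite integral_EFinZ ?mulr_ge0 ?sqrtr_ge0//; last first.
  by apply: measurable_indic; exact: measurable_box.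
rewrite integral_indic ?setIT; [|by []|exact: measurable_box].
rewrite [X in (_ * X <= _)%E](_ : _ = ((2 * b) ^+ m)%:E); last first.
  by apply: lebesgue_box; rewrite mulr_ge0// addr_ge0.
by rewrite -EFinM mulrC.
Qed.

End annulus.

(** * Summation over dyadic cubes *)
Section dyadic.
Context {R : realType} {n : nat}.
Local Notation mu := (lebesgue_tuple R n).
Local Notation mf f := (measurable_fun setT (f : n.-tuple R -> R)).
Implicit Types (c x y : n.-tuple R) (l : R).

Lemma integral_box c l : 0 <= l -> (\int[mu]_y (\1_(box c l) y)%:E = (l ^+ n)%:E)%E.
Proof.
move=> l0; rewrite integral_indic ?setIT//; last exact: measurable_box.
exact: lebesgue_box.
Qed.

(** For the least [k] containing [y], unless it is 0, the scale is comparable with the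
distance from [c] to [y]. *)
Lemma dyadic_scale c l y : 0 < l -> exists k : nat, box c (2 ^+ k * l) y /\
  (k = 0%N \/ exists i, 2 ^+ k * l / 4 < `|tnth y i - tnth c i|).
Proof.
move=> l0.
have ex : exists k : nat, `[< box c (2 ^+ k * l) y >].
  have [k hk] : exists k : nat, edist y c <= 2 ^+ k * l / 2.
    exists (Num.bound (edist y c / (l / 2))).
    rewrite -mulrA -ler_pdivrMr ?divr_gt0//.
    apply: le_trans (ltW (archi_boundP _)) _.
      by rewrite divr_ge0 ?edist_ge0// divr_ge0 ?ltW.
    by rewrite -natrX ler_nat ltnW// ltn_expl.
  exists k; apply/asboolP => i; apply: le_trans hk; exact: coord_le_edist.
case: (ex_minnP ex) => k /asboolP hk kmin; exists k; split => //.
case: k hk kmin => [|k] hk kmin; [by left|right].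
apply: contrapT => H; have : (k.+1 <= k)%N; last by rewrite ltnn.
apply: kmin; apply/asboolP => i; rewrite leNgt; apply/negP => hi.
apply: H; exists i; rewrite exprS.
by rewrite (_ : 2 * 2 ^+ k * l / 4 = 2 ^+ k * l / 2)//; field.
Qed.

Lemma edist_le_box c l x x' : 0 <= l -> box c l x -> box c l x' ->
  edist x x' <= n%:R * l.
Proof.
move=> l0 hx hx'; apply: edist_le_coord => // i.
have := hx i; have := hx' i; rewrite !ler_distl => /andP[? ?] /andP[? ?].
by apply/andP; split; lra.
Qed.

Lemma far_edist c l x y : box c l x -> ~ box c (5 * l) y -> 2 * l <= edist x y.
Proof.
move=> hx hy; rewrite leNgt; apply/negP => hxy; apply: hy => i.
have := coord_le_edist x y i; have := hx i; rewrite !ler_distl.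
by move=> /andP[? ?] /andP[? ?]; apply/andP; split; lra.
Qed.

(** Outside of the dilate by 5, the distance to every point of the cube is
comparable with the side of the least dyadic dilate containing [y], with the same
scale for all the points of the cube. *)
Lemma far_dyadic_scale c l y : 0 < l -> ~ box c (5 * l) y ->
  exists k : nat, [/\ (0 < k)%N, box c (2 ^+ k * l) y &
    forall x, box c l x -> 2 ^+ k * l <= 5 * edist x y].
Proof.
move=> l0 hy; have [k [hk hk']] := dyadic_scale c y l0; exists k.
case: hk' => [k0|[i hi]].
  by exfalso; apply: hy; apply: subset_box hk; rewrite k0 expr0; lra.
split => //.
  rewrite lt0n; apply/negP => /eqP k0; apply: hy; apply: subset_box hk.
  by rewrite k0 expr0; lra.
move=> x hx; have h2 := far_edist hx hy.
have h3 : 2 ^+ k * l / 4 - l / 2 <= edist x y.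
  apply: le_trans (coord_le_edist x y i).
  have := hx i; have := ler_distD (tnth x i) (tnth y i) (tnth c i).
  by rewrite (distrC (tnth y i) (tnth x i)) => ? ?; lra.
(* The bound by a coordinate loses [l / 2], harmless once [2 ^+ k >= 10]; for the
   few smaller scales the distance is at least [2 * l] anyway. *)
have [p10|p10] := leP 10 (2 ^+ k : R).
  have : 10 * l <= 2 ^+ k * l by rewrite ler_pM2r.
  by move: h3; set u := 2 ^+ k * l; lra.
have : 2 ^+ k * l <= 10 * l by rewrite ler_pM2r// ltW.
by move: h2; set u := 2 ^+ k * l; lra.
Qed.

(** A weight that is at most [w k] at points of the k-th dilate is dominated by the
sum of the [w k * \1_(box c (2 ^+ k * l))], which is integrated term by term. *)
Lemma dyadic_integral_le c l (g W : n.-tuple R -> R) (w : nat -> R) (A S : R) :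
  0 <= l -> (forall y, 0 <= g y) -> mf g -> (forall y, 0 <= W y) -> mf W ->
  (forall k, 0 <= w k) -> 0 <= A ->
  (forall k, (\int[mu]_y (g y * \1_(box c (2 ^+ k * l)) y)%:E <=
              (A * (2 ^+ k * l) ^+ n)%:E)%E) ->
  (forall y, W y != 0 -> exists2 k, box c (2 ^+ k * l) y & W y <= w k) ->
  (forall N : nat, \sum_(k < N) w k * (2 ^+ k * l) ^+ n <= S) ->
  (\int[mu]_y (W y * g y)%:E <= (A * S)%:E)%E.
Proof.
move=> l0 g0 mg W0 mW w0 A0 gA Ww wS.
have mb k : mf (\1_(box c (2 ^+ k * l))).
  by apply: measurable_indic; exact: measurable_box.
have mgb k : mf (fun y => g y * \1_(box c (2 ^+ k * l)) y).
  by apply: measurable_funM.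
have F0 k y : 0 <= w k * (g y * \1_(box c (2 ^+ k * l)) y).
  by rewrite !mulr_ge0// indicE.
apply: (@le_trans _ _ (\int[mu]_y
    (\sum_(0 <= k <oo) (w k * (g y * \1_(box c (2 ^+ k * l)) y))%:E))%E).
  apply: ge0_le_integral => //.
  - by move=> y _; rewrite lee_fin mulr_ge0.
  - by apply/measurable_EFinP; exact: measurable_funM.
  - apply: ge0_emeasurable_sum => [k y _ _|k _]; first by rewrite lee_fin.
    by apply/measurable_EFinP; apply: measurable_funM.
  move=> y _; have [->|/Ww[k hk Wk]] := eqVneq (W y) 0.
    by rewrite mul0r; apply: nneseries_ge0 => k _ _; rewrite lee_fin.
  apply: (@le_trans _ _ (\sum_(0 <= j < k.+1)
      (w j * (g y * \1_(box c (2 ^+ j * l)) y))%:E)%E); last first.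
    by apply: nneseries_lim_ge => j _ _; rewrite lee_fin.
  rewrite sumEFin lee_fin big_nat_recr//=.
  rewrite -[leLHS]add0r; apply: lerD; first by apply: sumr_ge0.
  by rewrite indicE mem_set// mulr1; apply: ler_wpM2r.
rewrite integral_nneseries//; last 2 first.
- by move=> k; apply/measurable_EFinP; apply: measurable_funM.
- by move=> k y _; rewrite lee_fin.
apply: lime_le.
  apply: is_cvg_nneseries => k _ _; apply: integral_ge0 => y _.
  by rewrite lee_fin.
apply: nearW => N; apply: (@le_trans _ _
    (\sum_(0 <= k < N) (w k * (A * (2 ^+ k * l) ^+ n))%:E)%E).
  apply: lee_sum => k _; rewrite integral_EFinZ//; last first.
    by move=> y; rewrite mulr_ge0// indicE.
  by rewrite EFinM; apply: lee_wpmul2l; rewrite ?lee_fin.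
rewrite sumEFin lee_fin big_mkord.
under eq_bigr do rewrite mulrCA.
rewrite -big_distrr/=; apply: ler_wpM2l => //; exact: wS.
Qed.

Lemma geometric_le (eps : R) N : 0 < eps ->
  \sum_(k < N) (2 ^+ k : R) `^ (- eps) <= (1 - 2 `^ (- eps))^-1.
Proof.
move=> e0; set rho := 2 `^ (- eps).
have rho0 : 0 < rho by exact: powR_gt0.
have rho1 : rho < 1.
  rewrite /rho powRN invf_lt1 ?powR_gt0//.
  suff : 1 `^ eps < 2 `^ eps by rewrite powR1.
  by apply: gt0_ltr_powR => //; rewrite ?nnegrE// ltr1n.
under eq_bigr => k _.
  rewrite -powR_mulrn// -powRrM mulrC powRrM powR_mulrn ?powR_ge0// -/rho.
  over.
rewrite -[leRHS]mul1r ler_pdivlMr ?subr_gt0// mulrC -opprB mulNr -subrX1.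
by rewrite opprB gerBl exprn_ge0// ltW.
Qed.

Lemma ler_powRN (a b s : R) : 0 < a -> a <= b -> 0 <= s -> b `^ (- s) <= a `^ (- s).
Proof.
move=> a0 ab s0; have b0 : 0 < b by exact: lt_le_trans ab.
rewrite !powRN lef_pV2 ?posrE ?powR_gt0//.
by apply: ge0_ler_powR; rewrite ?nnegrE// ltW.
Qed.

(** The scale [k] contributes [(2 ^+ k * l) `^ - (n + eps)] times the volume of the
dilate, hence a geometric series of ratio [2 `^ - eps]. *)
Lemma tail_integral_le c x l (O : set (n.-tuple R)) (g : n.-tuple R -> R) (A eps : R) :
  0 < l -> 0 < eps -> 0 <= A -> (forall y, 0 <= g y) -> mf g -> measurable O ->
  (forall k, (\int[mu]_y (g y * \1_(box c (2 ^+ k * l)) y)%:E <=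
              (A * (2 ^+ k * l) ^+ n)%:E)%E) ->
  (forall y, O y -> exists2 k, box c (2 ^+ k * l) y & 2 ^+ k * l <= 5 * edist x y) ->
  (\int[mu]_y (\1_O y * edist x y `^ (- (n%:R + eps)) * g y)%:E <=
   (A * (5 `^ (n%:R + eps) * (1 - 2 `^ (- eps))^-1 * l `^ (- eps)))%:E)%E.
Proof.
move=> l0 e0 A0 g0 mg mO gA hO.
have p0 k : 0 < 2 ^+ k * l :> R by rewrite mulr_gt0 ?exprn_gt0.
pose w k : R := 5 `^ (n%:R + eps) * (2 ^+ k * l) `^ (- (n%:R + eps)).
apply: (@dyadic_integral_le c l g _ w) => //.
- exact: ltW.
- by move=> y; rewrite mulr_ge0 ?powR_ge0// indicE.
- apply: measurable_funM; first exact: measurable_indic.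
  exact: measurable_edist_powR.
- by move=> k; rewrite mulr_ge0 ?powR_ge0.
- move=> y; rewrite indicE; case: (boolP (y \in O)); last by rewrite mul0r eqxx.
  rewrite inE mul1r => /hO[k hk hk'] _; exists k => //; rewrite /w.
  have -> : 5 `^ (n%:R + eps) * (2 ^+ k * l) `^ (- (n%:R + eps)) =
     (2 ^+ k * l / 5) `^ (- (n%:R + eps)).
    rewrite [in RHS]powRM ?invr_ge0// ?ltW// mulrC; congr (_ * _).
    by rewrite -[5^-1]powR_inv1// -powRrM mulN1r opprK.
  apply: ler_powRN; first by rewrite divr_gt0.
    by rewrite ler_pdivrMr// [leRHS]mulrC.
  by rewrite addr_ge0// ltW.
- move=> N; rewrite /w (eq_bigr (fun k : 'I_N => 5 `^ (n%:R + eps) * l `^ (- eps) *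
     (2 ^+ k : R) `^ (- eps))); last first.
    move=> k _; rewrite -!mulrA; congr (_ * _).
    rewrite -[(_ * _) ^+ n]powR_mulrn ?ltW// -powRD; last by rewrite (gt_eqF (p0 _)) implybT.
    rewrite opprD addrAC addNr add0r powRM ?ltW// ?exprn_ge0//.
    by rewrite mulrC.
  rewrite -big_distrr/= [leRHS]mulrAC; apply: ler_wpM2l; rewrite ?mulr_ge0 ?powR_ge0//.
  exact: geometric_le.
Qed.

(** Young's inequality bounds the product by [v `^ - (n * r') + f `^ r], where
[r' = r / (r - 1)] and [v] is the distance; the first term decays faster than [v ^- n],
by the exponent [eps = n / (r - 1)]. *)
Lemma integral_kernel_lt_pinfty (r eta : R) x (f : n.-tuple R -> R) :
  (0 < n)%N -> 1 < r -> 0 < eta -> (forall y, 0 <= f y) -> mf f ->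
  (\int[mu]_y (f y `^ r)%:E < +oo)%E ->
  (\int[mu]_y (\1_[set y | eta < edist x y] y * (edist x y ^+ n)^-1 * f y)%:E < +oo)%E.
Proof.
move=> n0 r1 eta0 f0 hf foo.
pose eps := n%:R / (r - 1).
have r10 : 0 < r - 1 by rewrite subr_gt0.
have e0 : 0 < eps by rewrite divr_gt0// ltr0n.
set O := [set y | eta < edist x y].
have mO : measurable O by exact: measurable_edist_gt.
have mO1 : mf (\1_O) by exact: measurable_indic.
have mfr : mf (fun y => f y `^ r) by exact: (measurableT_comp (measurable_powR _)).
apply: (@le_lt_trans _ _ (\int[mu]_y
   (\1_O y * edist x y `^ (- (n%:R + eps)) * 1 + f y `^ r)%:E)%E).
  apply: le_integral_EFin.
  - by move=> y; rewrite !mulr_ge0 ?invr_ge0 ?exprn_ge0 ?edist_ge0// indicE.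
  - apply: measurable_funM => //; apply: measurable_funM => //.
    exact: measurable_edist_exprV.
  - apply: measurable_funD => //.
    apply: measurable_funM => //; apply: measurable_funM => //.
    exact: measurable_edist_powR.
  move=> y; rewrite indicE; case: (boolP (y \in O)) => hy; last first.
    by rewrite !mul0r add0r powR_ge0.
  rewrite !mul1r mulr1.
  have v0 : 0 < edist x y by move: hy; rewrite inE /O/=; exact: lt_trans.
  have := @conjugate_powR R (edist x y ^+ n)^-1 (f y) (r / (r - 1)) r.
  rewrite invr_ge0 exprn_ge0 ?edist_ge0// => /(_ erefl (f0 y)).
  have -> : (r / (r - 1))^-1 + r^-1 = 1 by field; rewrite !gt_eqF//; lra.
  move=> /(_ _ _ erefl) H; apply: le_trans (H _ _) _; rewrite ?divr_gt0//; [lra|lra|].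
  apply: lerD.
    rewrite -powR_mulrn ?edist_ge0// -powRN -powRrM.
    have -> : - n%:R * (r / (r - 1)) = - (n%:R + eps).
      by rewrite /eps; field; rewrite gt_eqF.
    rewrite ler_pdivrMr ?divr_gt0//; last lra.
    by rewrite ler_peMr ?powR_ge0// ler_pdivlMr// mul1r; lra.
  by rewrite ler_pdivrMr ?ler_peMr ?powR_ge0//; lra.
rewrite integral_EFinD//; last 3 first.
- by move=> y; rewrite !mulr_ge0 ?powR_ge0// indicE.
- by move=> y; rewrite powR_ge0.
- apply: measurable_funM => //; apply: measurable_funM => //.
  exact: measurable_edist_powR.
rewrite lte_add_pinfty//.
apply: le_lt_trans (@tail_integral_le x x eta O (fun=> 1) 1 eps eta0 e0 ler01
  (fun=> ler01) _ mO _ _) _; last by rewrite ltry.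
- exact: measurable_cst.
- move=> k; under eq_integral do rewrite mul1r.
  by rewrite integral_box ?mul1r// mulr_ge0 ?exprn_ge0// ltW.
move=> y hy; have [k [hk hk']] := dyadic_scale x y eta0; exists k => //.
have v0 : 0 <= edist x y by exact: edist_ge0.
case: hk' => [->|[i hi]]; first by rewrite expr0 mul1r; move: hy; rewrite /O/=; lra.
have := coord_le_edist x y i; rewrite distrC => h.
by move: hi h v0; set u := 2 ^+ k * eta; lra.
Qed.

End dyadic.

(** * Complex-valued integrals *)
Section complex_integrals.
Context {R : realType} {n : nat}.
Local Notation mu := (lebesgue_tuple R n).
Local Notation mf f := (measurable_fun setT (f : n.-tuple R -> R)).
Local Notation cmod := (@Normc.normc R).
Local Notation cRe := (@complex.Re R).
Local Notation cIm := (@complex.Im R).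
Implicit Types (f g h : n.-tuple R -> R[i]) (z : R[i]).

Lemma cmodE z : cmod z = Num.sqrt (cRe z ^+ 2 + cIm z ^+ 2).
Proof. by case: z. Qed.

Lemma Re_le_cmod z : `|cRe z| <= cmod z.
Proof. by rewrite cmodE -sqrtr_sqr ler_wsqrtr// lerDl sqr_ge0. Qed.

Lemma Im_le_cmod z : `|cIm z| <= cmod z.
Proof. by rewrite cmodE -sqrtr_sqr ler_wsqrtr// lerDr sqr_ge0. Qed.

Lemma cmod_le_ReIm z : cmod z <= `|cRe z| + `|cIm z|.
Proof.
rewrite -(@ler_pXn2r _ 2)// ?nnegrE ?normc_ge0 ?addr_ge0//.
rewrite cmodE sqr_sqrtr ?addr_ge0 ?sqr_ge0// sqrrD !real_normK ?num_real//.
by rewrite lerD2r lerDl mulrn_wge0// mulr_ge0.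
Qed.

Lemma normcN z : cmod (- z) = cmod z.
Proof. by rewrite !cmodE; case: z => a b /=; rewrite !sqrrN. Qed.

Lemma normcD_le (z w : R[i]) : cmod (z + w) <= cmod z + cmod w.
Proof. exact: le_normcD. Qed.

Lemma normcB_le (z w : R[i]) : cmod (z - w) <= cmod z + cmod w.
Proof. by rewrite -(normcN w); exact: normcD_le. Qed.

Lemma cmod_realE (a : R) : cmod ((a%:C)%C) = `|a|.
Proof. by rewrite cmodE/= expr0n addr0 sqrtr_sqr. Qed.

Lemma ReB z w : cRe (z - w) = cRe z - cRe w. Proof. by case: z; case: w. Qed.
Lemma ImB z w : cIm (z - w) = cIm z - cIm w. Proof. by case: z; case: w. Qed.

Lemma cmeasurable_normc f : cmeasurable f -> mf (cmod \o f).
Proof.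
move=> [hr hi]; rewrite (_ : _ \o _ = (fun y => Num.sqrt (cRe (f y) ^+ 2 + cIm (f y) ^+ 2))).
  apply: (@measurableT_comp _ _ _ _ _ _ (@Num.sqrt R)).
    apply: nondecreasing_measurable => //; exact: ler_wsqrtr.
  by apply: measurable_funD; apply: measurable_funX.
by apply/funext => y /=; rewrite cmodE.
Qed.

Lemma cmeasurableM f g : cmeasurable f -> cmeasurable g ->
  cmeasurable (fun y => f y * g y).
Proof.
move=> [fr fi] [gr gi]; split.
  rewrite (_ : _ \o _ = (fun y => cRe (f y) * cRe (g y) - cIm (f y) * cIm (g y))).
    by apply: measurable_funB; apply: measurable_funM.
  by apply/funext => y /=; case: (f y); case: (g y).
rewrite (_ : _ \o _ = (fun y => cRe (f y) * cIm (g y) + cIm (f y) * cRe (g y))).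
  by apply: measurable_funD; apply: measurable_funM.
by apply/funext => y /=; case: (f y) => a b; case: (g y) => c d.
Qed.

Lemma cmeasurableB f g : cmeasurable f -> cmeasurable g ->
  cmeasurable (fun y => f y - g y).
Proof.
move=> [fr fi] [gr gi]; split.
  rewrite (_ : _ \o _ = (fun y => cRe (f y) - cRe (g y))).
    by apply: measurable_funB.
  by apply/funext => y /=; rewrite ReB.
rewrite (_ : _ \o _ = (fun y => cIm (f y) - cIm (g y))).
  by apply: measurable_funB.
by apply/funext => y /=; rewrite ImB.
Qed.

Lemma cindicE (A : set (n.-tuple R)) y : (\1_A y : R[i]) = ((\1_A y : R)%:C)%C.
Proof. by rewrite !indicE; case: (_ \in _). Qed.

Lemma cmod_indic (A : set (n.-tuple R)) y : cmod (\1_A y) = \1_A y.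
Proof. by rewrite cindicE cmod_realE ger0_norm// indicE. Qed.

Lemma cmeasurable_indic (A : set (n.-tuple R)) : measurable A ->
  cmeasurable (fun y => \1_A y : R[i]).
Proof.
move=> mA; split.
  rewrite (_ : _ \o _ = \1_A); first exact: measurable_indic.
  by apply/funext => y /=; rewrite cindicE.
rewrite (_ : _ \o _ = cst 0); first exact: measurable_cst.
by apply/funext => y /=; rewrite cindicE.
Qed.

Definition cintegrable f := cmeasurable f /\ (\int[mu]_y (cmod (f y))%:E < +oo)%E.

Lemma cintegrable_Re f : cintegrable f -> mu.-integrable setT (EFin \o (cRe \o f)).
Proof.
move=> [hf foo]; have [hr hi] := hf; apply/integrableP; split; first exact/measurable_EFinP.
apply: le_lt_trans foo; apply: ge0_le_integral => //.
- by apply: measurableT_comp => //; apply/measurable_EFinP.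
- by apply/measurable_EFinP; exact: cmeasurable_normc.
- by move=> y _; rewrite lee_fin Re_le_cmod.
Qed.

Lemma cintegrable_Im f : cintegrable f -> mu.-integrable setT (EFin \o (cIm \o f)).
Proof.
move=> [hf foo]; have [hr hi] := hf; apply/integrableP; split; first exact/measurable_EFinP.
apply: le_lt_trans foo; apply: ge0_le_integral => //.
- by apply: measurableT_comp => //; apply/measurable_EFinP.
- by apply/measurable_EFinP; exact: cmeasurable_normc.
- by move=> y _; rewrite lee_fin Im_le_cmod.
Qed.

Lemma cintegrable_le f (g : n.-tuple R -> R) : cmeasurable f -> mf g ->
  (forall y, cmod (f y) <= g y) -> (\int[mu]_y (g y)%:E < +oo)%E -> cintegrable f.
Proof.
move=> hf hg fg goo; split => //; apply: le_lt_trans goo.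
by apply: le_integral_EFin => // [y|]; [exact: normc_ge0|exact: cmeasurable_normc].
Qed.

Lemma cintegrableB f g : cintegrable f -> cintegrable g ->
  cintegrable (fun y => f y - g y).
Proof.
move=> [hf foo] [hg goo].
have mf' := cmeasurable_normc hf; have mg' := cmeasurable_normc hg.
apply: (@cintegrable_le _ (fun y => cmod (f y) + cmod (g y))).
- exact: cmeasurableB.
- exact: measurable_funD.
- by move=> y; exact: normcB_le.
rewrite integral_EFinD//; [exact: lte_add_pinfty| |] => y; exact: normc_ge0.
Qed.

Lemma cintegralB f g : cintegrable f -> cintegrable g ->
  cintegral setT (fun y => f y - g y) = cintegral setT f - cintegral setT g.
Proof.
move=> hf hg; rewrite /cintegral.
under eq_Rintegral do rewrite ReB.
under [X in (_ +i* X)%C]eq_Rintegral do rewrite ImB.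
rewrite (RintegralB _ (cintegrable_Re hf) (cintegrable_Re hg))//.
by rewrite (RintegralB _ (cintegrable_Im hf) (cintegrable_Im hg)).
Qed.

Lemma cmod_cintegral_le f : cintegrable f ->
  ((cmod (cintegral setT f))%:E <= 2%:E * \int[mu]_y (cmod (f y))%:E)%E.
Proof.
move=> hf; have [hf1 hf2] := hf.
have fin : (\int[mu]_y (cmod (f y))%:E)%E \is a fin_num.
  by rewrite ge0_fin_numE//; apply: integral_ge0 => y _; rewrite lee_fin normc_ge0.
have part (p : R[i] -> R) : (forall z, `|p z| <= cmod z) ->
    mu.-integrable setT (EFin \o (p \o f)) ->
    `|\int[mu]_y p (f y)| <= fine (\int[mu]_y (cmod (f y))%:E)%E.
  move=> pz ip; rewrite -lee_fin fineK//.
  have fp : (\int[mu]_y (p (f y))%:E)%E \is a fin_num by exact: integrable_fin_num.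
  rewrite -abse_EFin /Rintegral fineK//.
  apply: le_trans (le_abse_integral _ _ _) _ => //.
    by case/integrableP: ip.
  apply: ge0_le_integral => //.
  - by apply: measurableT_comp => //; case/integrableP: ip.
  - by apply/measurable_EFinP; exact: cmeasurable_normc.
  - by move=> y _; rewrite lee_fin.
rewrite -[X in (_ <= _ * X)%E](fineK fin) -EFinM lee_fin.
apply: le_trans (cmod_le_ReIm _) _; rewrite mulr_natl mulr2n; apply: lerD => /=.
  by apply: part; [exact: Re_le_cmod|exact: cintegrable_Re].
by apply: part; [exact: Im_le_cmod|exact: cintegrable_Im].
Qed.

Lemma cintegral_indic (D : set (n.-tuple R)) f :
  cintegral D f = cintegral setT (fun y => f y * \1_D y).
Proof.
rewrite /cintegral !(Rintegral_mkcond _ D).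
congr (_ +i* _)%C; apply: eq_Rintegral => y _; rewrite patchE indicE;
  by case: (_ \in _); rewrite ?mulr1 ?mulr0.
Qed.

End complex_integrals.

(** * Approximation by grid points *)
Section grid.
Context {R : realType} {n : nat}.

Definition grid (m : nat) (y : n.-tuple R) : n.-tuple R :=
  [tuple (Num.floor (2 ^+ m * tnth y i))%:~R / 2 ^+ m | i < n].

Lemma edist_grid m y : edist y (grid m y) <= n%:R * 2 ^- m.
Proof.
apply: edist_le_coord => // i; rewrite tnth_mktuple.
have p0 : 0 < 2 ^+ m :> R by rewrite exprn_gt0.
rewrite ger0_norm; last first.
  by rewrite subr_ge0 ler_pdivrMr// [leRHS]mulrC floor_le.
rewrite lerBlDr -{1}[2 ^- m]mul1r -mulrDl ler_pdivlMr// mulrC [leRHS]addrC -intrD1.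
by have /andP[_ /ltW] := floor_itv (2 ^+ m * tnth y i).
Qed.

(** Such a function takes countably many values, each on a countable union of
boxes; so [G] may be arbitrary. *)
Lemma measurable_grid_comp m (G : n.-tuple R -> R) :
  measurable_fun setT (G \o grid m).
Proof.
move=> _ Y mY; rewrite setTI.
pose P (z : n.-tuple int) : set (n.-tuple R) :=
  \bigcap_(i in [set: 'I_n])
    ((fun y => (Num.floor (2 ^+ m * tnth y i))%:~R : R) @^-1` [set (tnth z i)%:~R]).
pose val (z : n.-tuple int) : n.-tuple R := [tuple (tnth z i)%:~R / 2 ^+ m | i < n].
have mP z : measurable (P z).
  apply: fin_bigcap_measurable => // i _; rewrite -[X in measurable X]setTI.
  have : measurable_fun setT (fun y : n.-tuple R => (Num.floor (2 ^+ m * tnth y i))%:~R : R).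
    apply: (measurableT_comp (f := fun t : R => (Num.floor (2 ^+ m * t))%:~R : R)).
      apply: nondecreasing_measurable => // a b ab.
      by rewrite ler_int; apply: le_floor; apply: ler_wpM2l.
    exact: measurable_tnth.
  by apply => //; exact: measurable_set1.
pose F z := if `[< Y (G (val z)) >] then P z else set0.
rewrite (_ : _ @^-1` Y = \bigcup_z F z).
  apply: countable_bigcupT_measurable; first exact: countableP.
  by move=> z; rewrite /F; case: ifP.
have PE z y : P z y -> grid m y = val z.
  move=> Pz; apply/eq_from_tnth => i; rewrite !tnth_mktuple.
  by have /= -> := Pz i I.
apply/seteqP; split => [y Yy|y [z _]]; last first.
  by rewrite /F; case: asboolP => // YG /PE yz; rewrite /preimage/= yz.
pose z : n.-tuple int := [tuple Num.floor (2 ^+ m * tnth y i) | i < n].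
have Pz : P z y by move=> i _ /=; rewrite tnth_mktuple.
exists z => //; rewrite /F; case: asboolP => // -[].
by rewrite -(PE _ _ Pz).
Qed.

End grid.

(** * Dini moduli of continuity *)
Section modulus.
Context {R : realType} (omega : R -> R).
Hypothesis womega : modulus_of_continuity omega.

Lemma modulus_natM (m : nat) (t : R) : 0 <= t -> omega (m%:R * t) <= m%:R * omega t.
Proof.
move=> t0; elim: m => [|m IH]; first by rewrite !mul0r (modulus0 womega).
rewrite -addn1 natrD !mulrDl !mul1r.
apply: le_trans (modulus_subadditive womega _ _) _ => //; first by rewrite mulr_ge0.
by rewrite lerD2r.
Qed.

(** On the interval between [2 ^- k.+1] and [2 ^- k] the integrand [omega t / t] is
at least [omega (2 ^- k.+1) / 2 ^- k], and the length of the interval is half of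
[2 ^- k]. *)
Lemma dini_sum_le N :
  ((\sum_(k < N) omega (2 ^- k.+1))%:E <= 2%:E * dini_norm omega)%E.
Proof.
pose F t := omega (Num.max 0 t) * t `^ (-1).
have mF : measurable_fun setT (F : R -> R).
  apply: measurable_funM; last exact: measurable_powR.
  apply: nondecreasing_measurable => // s t st.
  apply: (modulus_le womega); first by rewrite le_max lexx.
  by rewrite ge_max !le_max lexx st orbT.
have F0 t : 0 <= F t.
  by rewrite mulr_ge0 ?powR_ge0// (modulus_ge0 womega)// le_max lexx.
have -> : dini_norm omega = (\int[@lebesgue_measure R]_(t in `]0%R, 1%R]) (F t)%:E)%E.
  apply: eq_integral => t; rewrite inE/= in_itv/= => /andP[t0 _].
  by rewrite /F powR_inv1 ?ltW// (max_idPr (ltW t0)).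
have mE (D : set R) : measurable_fun D (EFin \o F).
  by apply/measurable_EFinP; apply: measurable_funTS.
suff H : ((2^-1 * \sum_(k < N) omega (2 ^- k.+1))%:E <=
    \int[@lebesgue_measure R]_(t in `]2 ^- N, 1%R]) (F t)%:E)%E.
  rewrite (_ : \sum_(k < N) _ = 2 * (2^-1 * \sum_(k < N) omega (2 ^- k.+1))); last by field.
  rewrite EFinM; apply: lee_wpmul2l => //; apply: le_trans H _.
  apply: ge0_subset_integral => //; [exact: mE|by move=> t _; rewrite lee_fin|].
  apply: subset_itvr; rewrite bnd_simp invr_ge0 exprn_ge0//.
elim: N => [|N IH].
  rewrite big_ord0 mulr0; apply: integral_ge0 => t _; by rewrite lee_fin.
have p0 : 0 < 2 ^- N.+1 :> R by rewrite invr_gt0 exprn_gt0.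
have pS : 2 ^- N = 2 * 2 ^- N.+1 :> R by rewrite exprS; field.
have pN : 0 < 2 ^- N :> R by rewrite invr_gt0 exprn_gt0.
have p1 : 2 ^- N <= 1 :> R by rewrite invf_le1 ?exprn_gt0// exprn_ege1// ler1n.
rewrite (_ : `]2 ^- N.+1, 1%R]%classic =
   `]2 ^- N.+1, 2 ^- N] `|` `]2 ^- N, 1%R]); last first.
  by rewrite -itv_bndbnd_setU// bnd_simp//; lra.
rewrite ge0_integral_setU//=; last 3 first.
- exact: mE.
- by move=> t _; rewrite lee_fin.
- apply/disj_setPS => t [] /=; rewrite !in_itv/= => /andP[_ h1] /andP[h2 _].
  by move: (le_lt_trans h1 h2); rewrite ltxx.
rewrite big_ord_recr/= mulrDr EFinD addeC; apply: leeD => //.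
apply: (@le_trans _ _ (\int[@lebesgue_measure R]_(t in `]2 ^- N.+1, 2 ^- N])
    (cst (omega (2 ^- N.+1) / 2 ^- N)%:E t))%E).
  rewrite integral_cst//= lebesgue_measure_itv/= lte_fin ifT; last lra.
  rewrite -EFinB -EFinM lee_fin pS.
  rewrite (_ : _ / _ * _ = 2^-1 * omega (2 ^- N.+1))//.
  by field; rewrite gt_eqF// exprn_gt0.
apply: ge0_le_integral => //.
- move=> t _; rewrite lee_fin divr_ge0//.
  by apply: (modulus_ge0 womega); exact: ltW.
- exact: mE.
move=> t /=; rewrite in_itv/= => /andP[t1 t2].
have t0 : 0 < t by exact: lt_trans t1.
rewrite lee_fin /F (powR_inv1 (ltW t0)) (max_idPr (ltW t0)).
apply: ler_pM.
- by apply: (modulus_ge0 womega); exact: ltW.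
- by rewrite invr_ge0 ltW.
- by apply: (modulus_le womega); exact: ltW.
by rewrite lef_pV2 ?posrE.
Qed.

Lemma dini_sum_fin N : (dini_norm omega < +oo)%E ->
  \sum_(k < N) omega (2 ^- k.+1) <= 2 * fine (dini_norm omega).
Proof.
move=> doo; rewrite -lee_fin EFinM fineK ?dini_sum_le// ge0_fin_numE//.
apply: integral_ge0 => t; rewrite /= in_itv/= => /andP[t0 _].
by rewrite lee_fin divr_ge0 ?(modulus_ge0 womega)// ltW.
Qed.

(** A Dini modulus is continuous at 0: the sum of the [omega (2 ^- k)] for [k <= N] is
at least [N * omega (2 ^- N)] and stays bounded. *)
Lemma modulus_small (e : R) : (dini_norm omega < +oo)%E -> 0 < e ->
  exists2 d : R, 0 < d & forall t, 0 <= t -> t <= d -> omega t <= e.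
Proof.
move=> doo e0; pose S := 2 * fine (dini_norm omega).
pose N := (Num.bound (S / e)).+1.
exists (2 ^- N); first by rewrite invr_gt0 exprn_gt0.
move=> t t0 tN; apply: (@le_trans _ _ (omega (2 ^- N))); first exact: (modulus_le womega).
have S0 : 0 <= S.
  by have := dini_sum_fin 0 doo; rewrite big_ord0.
have h : N%:R * omega (2 ^- N) <= S.
  apply: le_trans (dini_sum_fin N doo).
  rewrite mulr_natl -[X in _ *+ X]card_ord -sumr_const; apply: ler_sum => k _.
  apply: (modulus_le womega); first by rewrite invr_ge0 exprn_ge0.
  by rewrite lef_pV2 ?posrE ?exprn_gt0// ler_eXn2l// ltr1n.
have SN : S / e < N%:R.
  apply: lt_trans (archi_boundP _) _; first by rewrite divr_ge0// ltW.
  by rewrite ltr_nat.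
rewrite leNgt; apply/negP => he.
have N0 : 0 < N%:R :> R by rewrite ltr0n.
have : N%:R * e < S by apply: lt_le_trans h; rewrite ltr_pM2l.
by move: SN; rewrite ltr_pdivrMr// => h1 h2; have := lt_trans h1 h2; rewrite ltxx.
Qed.

End modulus.

(** * Measurability and integrability of the kernel *)
Section kernels.
Context {R : realType} {n : nat}.
Local Notation mu := (lebesgue_tuple R n).
Local Notation mf f := (measurable_fun setT (f : n.-tuple R -> R)).
Local Notation cmod := (@Normc.normc R).
Local Notation cRe := (@complex.Re R).
Local Notation cIm := (@complex.Im R).
Variables (omega : R -> R) (CK : R) (K : n.-tuple R -> n.-tuple R -> R[i]).
Hypotheses (womega : modulus_of_continuity omega) (CK0 : 0 < CK)
  (domega : (dini_norm omega < +oo)%E) (KK : CZ_kernel omega CK K).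
Implicit Types x y : n.-tuple R.

(** The kernel is arbitrary on the diagonal; giving it the value 0 there makes it
measurable in [y] without changing any truncation. *)
Definition offdiag (K : n.-tuple R -> n.-tuple R -> R[i]) x y : R[i] :=
  if x == y then 0 else K x y.

Lemma offdiag_size x y : cmod (offdiag K x y) <= CK / edist x y ^+ n.
Proof.
rewrite /offdiag; case: eqVneq => [<-|xy]; last exact: (CZ_kernel_size KK).
by rewrite cmodE/= expr0n addr0 sqrtr0 divr_ge0 ?exprn_ge0 ?edist_ge0// ltW.
Qed.

Lemma kernel_grid_cvg x y (e : R) : x != y -> 0 < e ->
  \forall m \near \oo, cmod (K x y - K x (grid m y)) <= e.
Proof.
move=> xy e0; have v0 := edist_gt0 xy.
pose a := CK / edist x y ^+ n.
have a0 : 0 < a by rewrite divr_gt0// exprn_gt0.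
have [d d0 hd] := modulus_small womega domega (divr_gt0 e0 a0).
pose s := Num.min (2^-1 * edist x y) (d * edist x y).
have s0 : 0 < s by rewrite lt_min !mulr_gt0.
pose M := Num.bound (n%:R / s).
near=> m.
have hm : edist y (grid m y) <= s.
  apply: le_trans (edist_grid m y) _.
  rewrite ler_pdivrMr ?exprn_gt0// mulrC -ler_pdivrMr//.
  apply: le_trans (ltW (archi_boundP _)) _; first by rewrite divr_ge0// ltW.
  rewrite -natrX ler_nat; apply: (@leq_trans m); last by rewrite ltnW// ltn_expl.
  by near: m; exists M => //.
apply: le_trans (CZ_kernel_regr KK xy _) _.
  by apply: le_trans hm _; rewrite ge_min lexx.
rewrite -/a -ler_pdivlMl// [leRHS]mulrC; apply: hd.
  by rewrite divr_ge0 ?edist_ge0.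
rewrite ler_pdivrMr//; apply: le_trans hm _; by rewrite ge_min lexx orbT.
Unshelve. all: by end_near.
Qed.

(** The kernel is continuous in [y] off the diagonal because the modulus vanishes at
0, so it is the pointwise limit of its values at the grid points. *)
Lemma cmeasurable_offdiag x : cmeasurable (offdiag K x).
Proof.
have mne : measurable [set y | 0 < edist x y] by exact: measurable_edist_gt.
have neE y : \1_[set y | 0 < edist x y] y = (x != y)%:R :> R.
  rewrite indicE; congr (nat_of_bool _)%:R; apply/idP/idP.
    by rewrite inE/=; apply: contraTneq => <-; rewrite edistxx ltxx.
  by move=> xy; rewrite inE/=; exact: edist_gt0.
suff H (p : R[i] -> R) : p 0 = 0 -> (forall z, `|p z| <= cmod z) ->
    (forall z w, p (z - w) = p z - p w) -> mf (p \o offdiag K x).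
  split; apply: H => //; [exact: Re_le_cmod|exact: ReB|exact: Im_le_cmod|exact: ImB].
move=> p0 pz pB.
apply: (@measurable_fun_cvg _ _ _ _
  (fun m y => p (K x (grid m y)) * \1_[set y | 0 < edist x y] y)).
  move=> m; apply: measurable_funM; last exact: measurable_indic.
  exact: (measurable_grid_comp m (fun y => p (K x y))).
move=> y _ /=; apply/cvgrPdist_le => e e0; rewrite neE /offdiag.
have [xy|xy] := eqVneq x y.
  by apply: nearW => m; rewrite mulr0 p0 subr0 normr0 ltW.
have := kernel_grid_cvg xy e0; apply: filterS => m hm.
by rewrite mulr1 -pB; apply: le_trans hm.
Qed.

Lemma truncationsE (f : n.-tuple R -> R[i]) x (eta : R) : 0 < eta ->
  truncations K f x eta =
  cintegral setT (fun y => offdiag K x y * f y * \1_[set y | eta < edist x y] y).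
Proof.
move=> eta0; rewrite /truncations cintegral_indic; congr cintegral; apply/funext => y.
rewrite /offdiag; case: eqVneq => [->|//].
by rewrite indicE memNset ?mulr0//= edistxx ltNge ltW.
Qed.

Lemma cLp_integral (r : R) (f : n.-tuple R -> R[i]) : 0 < r -> cLp r f ->
  (\int[mu]_y (cmod (f y) `^ r)%:E < +oo)%E.
Proof.
move=> r0 [hf foo].
have := @poweR_Lnorm _ _ _ mu (EFin \o (cmod \o f)) r; rewrite gt_eqF// => /(_ isT) H.
rewrite (_ : (\int[mu]_y _)%E = (\int[mu]_x `|(EFin \o (cmod \o f)) x| `^ r)%E).
  by rewrite -H poweR_lty.
by apply: eq_integral => y _; rewrite /= ger0_norm// normc_ge0.
Qed.

Lemma cintegrable_truncation (r eta : R) (f : n.-tuple R -> R[i]) x :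
  (0 < n)%N -> 1 < r -> 0 < eta -> cmeasurable f ->
  (\int[mu]_y (cmod (f y) `^ r)%:E < +oo)%E ->
  cintegrable (fun y => offdiag K x y * f y * \1_[set y | eta < edist x y] y).
Proof.
move=> n0 r1 eta0 hf foo.
have mcf := cmeasurable_normc hf.
pose W y := \1_[set y | eta < edist x y] y * (edist x y ^+ n)^-1 * cmod (f y).
have mW : mf W.
  apply: measurable_funM => //; apply: measurable_funM.
    by apply: measurable_indic; exact: measurable_edist_gt.
  exact: measurable_edist_exprV.
have W0 y : 0 <= W y.
  by rewrite /W !mulr_ge0 ?normc_ge0 ?invr_ge0 ?exprn_ge0 ?edist_ge0// indicE.
apply: (@cintegrable_le _ _ _ (fun y => CK * W y)).
- apply: cmeasurableM; last first.
    by apply: cmeasurable_indic; exact: measurable_edist_gt.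
  by apply: cmeasurableM; [exact: cmeasurable_offdiag|exact: hf].
- by apply: measurable_funM.
- move=> y; rewrite !Normc.normcM cmod_indic /W.
  rewrite (_ : CK * _ = CK / edist x y ^+ n * cmod (f y) *
     \1_[set y | eta < edist x y] y); last by ring.
  apply: ler_wpM2r; first by rewrite indicE.
  by apply: ler_wpM2r; [exact: normc_ge0|exact: offdiag_size].
rewrite integral_EFinZ ?ltW// lte_mul_pinfty//; first by rewrite lee_fin ltW.
by apply: (@integral_kernel_lt_pinfty _ _ r) => // y; exact: normc_ge0.
Qed.

End kernels.

(** * Averages over cubes *)
Section averages.
Context {R : realType} {n : nat}.
Local Notation mu := (lebesgue_tuple R n).
Local Notation mf f := (measurable_fun setT (f : n.-tuple R -> R)).
Local Notation cmod := (@Normc.normc R).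
Implicit Types (c : n.-tuple R) (f : n.-tuple R -> R[i]).

Lemma average_ge0 (r : R) (A : set (n.-tuple R)) f : (0 <= average r A f)%E.
Proof. exact: poweR_ge0. Qed.

(** Lets an upper bound [A], which may vanish or be infinite, be replaced by an
arbitrary real number above it. *)
Lemma lee_forall_gt (X A : \bar R) (c : R) : 0 < c -> (0 <= A)%E ->
  (forall M : R, (A < M%:E)%E -> (X <= (c * M)%:E)%E) -> (X <= c%:E * A)%E.
Proof.
move=> c0; case: A => [a||//] a0 H; last by rewrite gt0_muley ?leey// lte_fin.
rewrite -EFinM; apply/lee_addgt0Pr => e e0.
have -> : ((c * a)%:E + e%:E = (c * (a + e / c))%:E)%E.
  by rewrite -EFinD; congr EFin; field; rewrite gt_eqF.
by apply: H; rewrite lte_fin ltrDl divr_gt0.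
Qed.

Lemma integral_powR_le_average (r s M : R) c f : 0 < r -> 0 < s -> 0 <= M ->
  cmeasurable f -> (average r (box c s) f <= M%:E)%E ->
  (\int[mu]_y (cmod (f y) `^ r * \1_(box c s) y)%:E <= (M `^ r * s ^+ n)%:E)%E.
Proof.
move=> r0 s0 M0 hf; rewrite /average.
have sn : 0 < s ^+ n by rewrite exprn_gt0.
have -> : fine (mu (box c s)) = s ^+ n by rewrite lebesgue_box// ltW.
have -> : (\int[mu]_(y in box c s) (cmod (f y) `^ r)%:E =
    \int[mu]_y (cmod (f y) `^ r * \1_(box c s) y)%:E)%E.
  rewrite integral_mkcond; apply: eq_integral => y _; rewrite patchE indicE.
  by case: (_ \in _); rewrite ?mulr1 ?mulr0.
set I := (\int[mu]_y _)%E.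
have I0 : (0 <= I)%E.
  by apply: integral_ge0 => y _; rewrite lee_fin mulr_ge0 ?powR_ge0// indicE.
have J0 : (0 <= ((s ^+ n)^-1)%:E * I)%E by rewrite mule_ge0// lee_fin invr_ge0 ltW.
move=> H; have H' : (((s ^+ n)^-1)%:E * I <= (M `^ r)%:E)%E.
  rewrite -[leLHS]poweRe1// -(@mulVf _ r) ?gt_eqF// poweRrM -poweR_EFin.
  apply: gt0_ler_poweR => //; first exact: ltW.
    by rewrite in_itv/= leey andbT poweR_ge0.
  by rewrite in_itv/= leey andbT.
have -> : I = ((s ^+ n)%:E * (((s ^+ n)^-1)%:E * I))%E.
  by rewrite muleA -EFinM divff ?mul1e// gt_eqF.
by rewrite mulrC EFinM; apply: lee_wpmul2l => //; rewrite lee_fin ltW.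
Qed.

(** Integrates the pointwise bound [t <= M + M `^ (1 - r) * t `^ r], which is trivial
both for [t <= M] and for [M <= t]. *)
Lemma integral_le_average (r s M : R) c f : 1 < r -> 0 < s -> 0 < M ->
  cmeasurable f -> (average r (box c s) f <= M%:E)%E ->
  (\int[mu]_y (cmod (f y) * \1_(box c s) y)%:E <= (2 * M * s ^+ n)%:E)%E.
Proof.
move=> r1 s0 M0 hf Hf; have r0 : 0 < r by exact: lt_trans r1.
have mcf := cmeasurable_normc hf.
have mb : mf (\1_(box c s)) by apply: measurable_indic; exact: measurable_box.
have mfr : mf (fun y => cmod (f y) `^ r) by exact: (measurableT_comp (measurable_powR _)).
have H := integral_powR_le_average r0 s0 (ltW M0) hf Hf.
apply: (@le_trans _ _ (\int[mu]_y (M * \1_(box c s) y +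
    M `^ (1 - r) * (cmod (f y) `^ r * \1_(box c s) y))%:E)%E).
  apply: le_integral_EFin.
  - by move=> y; rewrite mulr_ge0 ?normc_ge0// indicE.
  - exact: measurable_funM.
  - apply: measurable_funD; apply: measurable_funM => //.
    exact: measurable_funM.
  move=> y; rewrite mulrA -mulrDl; apply: ler_wpM2r; first by rewrite indicE.
  set a := cmod (f y); have a0 : 0 <= a by exact: normc_ge0.
  have [aM|Ma] := leP a M; first by rewrite -[leLHS]addr0 lerD// mulr_ge0 ?powR_ge0.
  have a1 : 0 < a by exact: lt_trans Ma.
  rewrite -[leLHS]add0r; apply: lerD; first exact: ltW.
  rewrite -[leLHS]powRr1//.
  have -> : a `^ 1 = a `^ (1 - r) * a `^ r.
    by rewrite -powRD ?subrK// (gt_eqF a1) implybT.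
  apply: ler_wpM2r; first exact: powR_ge0.
  by rewrite -[1 - r]opprB; apply: ler_powRN => //; [exact: ltW|lra].
rewrite integral_EFinD//; last 4 first.
- by move=> y; rewrite mulr_ge0 ?(ltW M0)// indicE.
- by move=> y; rewrite !mulr_ge0 ?powR_ge0// indicE.
- exact: measurable_funM.
- by apply: measurable_funM => //; exact: measurable_funM.
rewrite !integral_EFinZ ?powR_ge0//; last 3 first.
- by move=> y; rewrite mulr_ge0 ?powR_ge0// indicE.
- exact: measurable_funM.
- exact: ltW.
rewrite integral_box ?(ltW s0)//.
rewrite -mulrA mulr_natl mulr2n EFinD EFinM; apply: leeD => //.
apply: (@le_trans _ _ ((M `^ (1 - r))%:E * (M `^ r * s ^+ n)%:E)%E).
  by apply: lee_wpmul2l => //; rewrite lee_fin powR_ge0.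
rewrite -!EFinM lee_fin mulrA -powRD ?subrK ?powRr1 ?(ltW M0)//.
by rewrite (gt_eqF M0) implybT.
Qed.

End averages.

(** * Variation of a family of integrals *)
Section variation_of_integrals.
Context {R : realType} {n : nat}.
Local Notation mu := (lebesgue_tuple R n).
Local Notation mf f := (measurable_fun setT (f : n.-tuple R -> R)).
Local Notation cmod := (@Normc.normc R).

(** The increments along a sequence are bounded by two kinds of integrands: the
[psi j], whose integrals are summable, and the [phi j], whose integrals are only
summable to the power [p]. The factor 8 comes from splitting complex integrals
into real and imaginary parts and from [sum_powRD_le]. *)
Lemma variation_cintegral_le (p q B C : R) (a : R -> R[i])
    (F : R -> n.-tuple R -> R[i]) :
  1 <= p -> p <= q -> 0 <= B -> 0 <= C ->
  (forall eta, 0 < eta -> cintegrable (F eta) /\ a eta = cintegral setT (F eta)) ->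
  (forall eta : nat -> R, (forall j, 0 < eta j) -> nonincreasing_seq eta ->
    exists psi phi : nat -> n.-tuple R -> R,
    [/\ forall j y, 0 <= psi j y /\ 0 <= phi j y,
        forall j, mf (psi j) /\ mf (phi j),
        forall j y, cmod (F (eta j) y - F (eta j.+1) y) <= psi j y + phi j y,
        forall N, (\sum_(j < N) \int[mu]_y (psi j y)%:E <= B%:E)%E &
        forall N, (\sum_(j < N) (\int[mu]_y (phi j y)%:E) `^ p <= (C `^ p)%:E)%E]) ->
  (variation_norm q a <= (8 * (B + C))%:E)%E.
Proof.
move=> p1 pq B0 C0 aF H.
have p0 : 0 < p by exact: lt_le_trans p1.
apply: variation_norm_le; [lra|by rewrite mulr_ge0// addr_ge0|].
move=> eta eta0 etan N; have [psi [phi [ge0 mpp Fle Bsum Csum]]] := H eta eta0 etan.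
have psi0 j : (0 <= \int[mu]_y (psi j y)%:E)%E.
  by apply: integral_ge0 => y _; rewrite lee_fin (ge0 j y).1.
have phi0 j : (0 <= \int[mu]_y (phi j y)%:E)%E.
  by apply: integral_ge0 => y _; rewrite lee_fin (ge0 j y).2.
have psifin j : (\int[mu]_y (psi j y)%:E)%E \is a fin_num.
  rewrite ge0_fin_numE//; apply: (@le_lt_trans _ _ B%:E); last by rewrite ltry.
  apply: le_trans (Bsum j.+1); rewrite big_ord_recr/= leeDr//.
  by apply: sume_ge0 => i _.
have phifin j : (\int[mu]_y (phi j y)%:E)%E \is a fin_num.
  rewrite ge0_fin_numE// ltey; apply/eqP => oo.
  have := Csum j.+1; rewrite big_ord_recr/= oo poweRyr ?gt_eqF// addey//.
  rewrite -ltNye; apply: (@lt_le_trans _ _ 0%E) => //.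
  by apply: sume_ge0 => i _; exact: poweR_ge0.
pose b j := fine (\int[mu]_y (psi j y)%:E)%E.
pose c j := fine (\int[mu]_y (phi j y)%:E)%E.
have bE j : (\int[mu]_y (psi j y)%:E)%E = (b j)%:E by rewrite fineK.
have cE j : (\int[mu]_y (phi j y)%:E)%E = (c j)%:E by rewrite fineK.
have -> : 8 * (B + C) = 4 * (2 * B + 2 * C) by ring.
apply: (@sum_powRD_le _ p q _ _ (fun j => 2 * b j) (fun j => 2 * c j)
  (fun j => cmod (a (eta j) - a (eta j.+1)))) => //.
- by rewrite mulr_ge0.
- by rewrite mulr_ge0.
- by move=> j; rewrite mulr_ge0// fine_ge0.
- by move=> j; rewrite mulr_ge0// fine_ge0.
- by move=> j; exact: normc_ge0.
- move=> j; have [Fj aj] := aF _ (eta0 j); have [Fj1 aj1] := aF _ (eta0 j.+1).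
  rewrite /= aj aj1 -cintegralB// -lee_fin.
  apply: le_trans (cmod_cintegral_le (cintegrableB Fj Fj1)) _.
  rewrite -mulrDr EFinM [(b j + c j)%:E]EFinD -[(b j)%:E]bE -[(c j)%:E]cE; apply: lee_wpmul2l => //.
  have [m1 m2] := mpp j.
  rewrite -integral_EFinD//; [|by move=> y; exact: (ge0 j y).1|by move=> y; exact: (ge0 j y).2].
  apply: le_integral_EFin => //.
  + by move=> y; exact: normc_ge0.
  + by apply: cmeasurable_normc; apply: cmeasurableB; [case: Fj|case: Fj1].
  + exact: measurable_funD.
- rewrite -big_distrr/= ler_pM2l// -lee_fin -sumEFin.
  under eq_bigr do rewrite -bE.
  exact: Bsum.
- rewrite powRM// (eq_bigr (fun j : 'I_N => 2 `^ p * c j `^ p)); last first.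
    by move=> j _; rewrite powRM// fine_ge0.
  rewrite -big_distrr/= ler_pM2l ?powR_gt0// -lee_fin -sumEFin.
  under eq_bigr do rewrite -poweR_EFin -cE.
  exact: Csum.
Qed.

End variation_of_integrals.

(** * Shells and thin annuli *)
Lemma poweRD_le {R : realType} (r : R) (a b : \bar R) : 0 < r -> (0 <= a)%E -> (0 <= b)%E ->
  ((a + b) `^ r <= (2 `^ r)%:E * (a `^ r + b `^ r))%E.
Proof.
move=> r0; have two : (0 < (2 `^ r)%:E :> \bar R)%E by rewrite lte_fin powR_gt0.
have rn : r != 0 by rewrite gt_eqF.
case: a => [a| |] //; case: b => [b| |] // a0 b0.
- by rewrite !poweR_EFin -!EFinD -EFinM lee_fin; apply: powRD_le => //; exact: ltW.
- by rewrite addey// poweRyr// addey// gt0_muley// leey.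
- by rewrite addye// poweRyr// addye// gt0_muley// leey.
- by rewrite addye// poweRyr// addye// gt0_muley// leey.
Qed.

Section shells.
Context {R : realType} {n : nat}.
Local Notation mu := (lebesgue_tuple R n).
Local Notation mf f := (measurable_fun setT (f : n.-tuple R -> R)).
Implicit Types (x y : n.-tuple R) (eta : nat -> R).

Definition outside (s : R) x y : R := (s < edist x y)%R%:R.

Lemma outsideE s x y : \1_[set y | s < edist x y] y = outside s x y.
Proof.
rewrite indicE /outside; congr (nat_of_bool _)%:R.
by apply/idP/idP => [|h]; rewrite inE.
Qed.

Lemma measurable_outside s x : mf (outside s x).
Proof.
rewrite (_ : outside s x = \1_[set y | s < edist x y]).
  by apply: measurable_indic; exact: measurable_edist_gt.
by apply/funext => y; rewrite outsideE.
Qed.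

(** For a nonincreasing [eta], the indicator function of the annulus of radii
[eta j.+1] and [eta j] around [x], written as a difference so that sums telescope. *)
Definition shell eta x (j : nat) y : R := outside (eta j.+1) x y - outside (eta j) x y.

Lemma measurable_shell eta x j : mf (shell eta x j).
Proof. by apply: measurable_funB; exact: measurable_outside. Qed.

Lemma shell_ge0 eta x j y : nonincreasing_seq eta -> 0 <= shell eta x j y.
Proof.
move=> etan; rewrite subr_ge0 ler_nat /outside.
by case: ltP => // h; rewrite (le_lt_trans (etan _ _ (leqnSn j)) h).
Qed.

Lemma shell_le1 eta x j y : shell eta x j y <= 1.
Proof. by rewrite /shell/outside; do 2 case: ltP => _ /=; lra. Qed.

Lemma sum_shell_le1 eta x y N : \sum_(j < N) shell eta x j y <= 1.
Proof.
rewrite -(big_mkord xpredT (fun j => shell eta x j y)) /shell.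
rewrite (@telescope_sumr _ 0 N (fun j => outside (eta j) x y))// /outside.
by do 2 case: ltP => _ /=; lra.
Qed.

Lemma sum_integral_le (m : R) (w : nat -> n.-tuple R -> R) (g : n.-tuple R -> R) N :
  0 <= m -> (forall j y, 0 <= w j y) -> (forall j, mf (w j)) ->
  (forall y, \sum_(j < N) w j y <= m) ->
  (forall y, 0 <= g y) -> mf g ->
  (\sum_(j < N) \int[mu]_y (w j y * g y)%:E <= m%:E * \int[mu]_y (g y)%:E)%E.
Proof.
move=> m0 w0 mw wm g0 mg.
have mwg j : mf (fun y => w j y * g y) by exact: measurable_funM.
rewrite -(@integral_EFin_sum _ _ _ mu (fun j y => w j y * g y))//; last first.
  by move=> j y; rewrite mulr_ge0.
rewrite -integral_EFinZ//; apply: le_integral_EFin.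
- by move=> y; apply: sumr_ge0 => j _; rewrite mulr_ge0.
- exact: measurable_sum.
- exact: measurable_funM.
- by move=> y; rewrite -big_distrl/=; apply: ler_wpM2r.
Qed.

(** Changing the centre by [d] only affects the points within distance [d] of one of
the two boundary spheres of the shell. *)
Lemma shell_sub eta x x' y j (d : R) : edist x x' <= d ->
  shell eta x j y != shell eta x' j y ->
  (eta j - d <= edist x' y <= eta j + d) || (eta j.+1 - d <= edist x' y <= eta j.+1 + d).
Proof.
move=> hd; have := edist_lipschitz x x' y; move=> /le_trans/(_ hd).
rewrite ler_distl => /andP[h1 h2].
have near s : outside s x y != outside s x' y -> s - d <= edist x' y <= s + d.
  rewrite /outside; case: ltP => a; case: ltP => b; rewrite ?eqxx// => _;
  by apply/andP; split; lra.
rewrite /shell; have [e1|/near ->] := eqVneq (outside (eta j) x y) (outside (eta j) x' y).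
  have [e2|/near ->] := eqVneq (outside (eta j.+1) x y) (outside (eta j.+1) x' y).
    by rewrite e1 e2 eqxx.
  by rewrite orbT.
by [].
Qed.

End shells.

Section thin_shell.
Context {R : realType} {n : nat}.
Local Notation mu := (lebesgue_tuple R n).
Local Notation mf f := (measurable_fun setT (f : n.-tuple R -> R)).

(** The constant that [lebesgue_annulus_le] produces for an annulus of
half-width [n * l] and outer radius at most [n.+1] times the distance to the centre. *)
Definition thin_cst : R := (2 * n.+1%:R) ^+ n.-1 * (4 * Num.sqrt (n%:R * n.+1%:R)).

Lemma thin_measure_le (l v : R) : (0 < n)%N -> 0 < l -> 0 < v ->
  (2 * (n.+1%:R * v)) ^+ n.-1 * (4 * Num.sqrt (n%:R * l * (n.+1%:R * v))) =
  thin_cst * l `^ 2^-1 * v `^ (n%:R - 2^-1).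
Proof.
move=> n0 l0 v0; rewrite /thin_cst mulrA exprMn.
rewrite (_ : n%:R * l * (n.+1%:R * v) = (n%:R * n.+1%:R) * (l * v)); last by ring.
rewrite [Num.sqrt (_ * (l * v))]sqrtrM ?mulr_ge0// [Num.sqrt (l * v)]sqrtrM ?(ltW l0)//.
rewrite -(powR12_sqrt (ltW l0)) -(powR12_sqrt (ltW v0)).
have -> : n%:R - 2^-1 = n.-1%:R + 2^-1 :> R.
  by rewrite -{1}(prednK n0) -addn1 natrD; field.
rewrite powRD ?(gt_eqF v0) ?implybT// powR_mulrn ?ltW//; ring.
Qed.

(** On a thin annulus meeting the complement of the fivefold cube, [S = s + n * l] is
comparable with the distance [v] to [x], so the measure of the annulus is
at most a multiple of [l `^ 2^-1 * v `^ (n - 2^-1)]. Hoelder's inequality then turns the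
weight [v ^- n] into [l `^ eps * v `^ - (n + eps)] for the r-th powers, where
[eps = (r - 1) / 2] because
[(n - 1 / 2) * (r - 1) - n * r = - n - (r - 1) / 2]: the weight is integrable at
infinity and the estimate is additive in [G `^ r]. *)
Lemma thin_shell_le (c x : n.-tuple R) (l s r : R) (G : n.-tuple R -> R) :
  (0 < n)%N -> 1 < r -> 0 < l -> 0 < s -> box c l x -> (forall y, 0 <= G y) -> mf G ->
  ((\int[mu]_y ((edist x y ^+ n)^-1 * \1_(~` box c (5 * l)) y * G y *
      \1_[set y | (s - n%:R * l <= edist x y <= s + n%:R * l)%R] y)%:E) `^ r <=
   (thin_cst `^ (r - 1) * l `^ ((r - 1) / 2))%:E *
   \int[mu]_y (\1_(~` box c (5 * l)) y *
     edist x y `^ (- (n%:R + (r - 1) / 2)) * G y `^ r)%:E)%E.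
Proof.
set O := ~` box c (5 * l); set E := [set y | _]; set eps := (r - 1) / 2.
move=> n0 r1 l0 s0 hx G0 mG.
have r0 : 0 < r by exact: lt_trans r1.
have r10 : 0 < r - 1 by rewrite subr_gt0.
have nl0 : 0 <= n%:R * l by rewrite mulr_ge0 ?ler0n// ltW.
pose S := s + n%:R * l.
have S0 : 0 <= S by rewrite addr_ge0// ltW.
pose m := (2 * S) ^+ n.-1 * (4 * Num.sqrt (n%:R * l * S)).
have m0 : 0 <= m by rewrite !mulr_ge0 ?exprn_ge0 ?sqrtr_ge0// mulr_ge0.
have mO : measurable O by apply: measurableC; exact: measurable_box.
have mE : measurable E.
  rewrite (_ : E = setT `&` edist x @^-1` `[s - n%:R * l, S]).
    exact: measurable_edist.
  by rewrite setTI; apply/seteqP; split => t /=; rewrite in_itv.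
have mEO : measurable (O `&` E) by exact: measurableI.
have Em : (mu (O `&` E) <= m%:E)%E.
  apply: (@le_trans _ _ (mu E)); first by apply: le_measure; rewrite ?inE.
  rewrite /E /m /S; case: n n0 x nl0 {hx S S0 m m0 E mE mEO mO O G0 mG G c} => // m _ x nl0.
  by apply: lebesgue_annulus_le => //; exact: ltW.
have mpow a := measurable_edist_powR x a.
have minv := measurable_edist_exprV x n.
have inv0 y : 0 <= (edist x y ^+ n)^-1 by rewrite invr_ge0 exprn_ge0// edist_ge0.
have mg : mf (fun y => (edist x y ^+ n)^-1 * G y) by exact: measurable_funM.
have g0 y : 0 <= (edist x y ^+ n)^-1 * G y by rewrite mulr_ge0.
have mO1 : mf (\1_O) by exact: measurable_indic.
have mEO1 : mf (\1_(O `&` E)) by exact: measurable_indic.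
have mpr (u : n.-tuple R -> R) : mf u -> mf (fun y => u y `^ r).
  by move=> mu; exact: (measurableT_comp (measurable_powR _)).
have -> : (\int[mu]_y ((edist x y ^+ n)^-1 * \1_O y * G y * \1_E y)%:E =
    \int[mu]_y ((edist x y ^+ n)^-1 * G y * \1_(O `&` E) y)%:E)%E.
  by apply: eq_integral => y _; rewrite indicI/=; congr EFin; ring.
apply: le_trans (hoelder_indic r1 m0 mEO Em mg g0) _.
have gr0 y : 0 <= ((edist x y ^+ n)^-1 * G y) `^ r * \1_(O `&` E) y.
  by rewrite mulr_ge0 ?powR_ge0// indicE.
have w0 y : 0 <= \1_O y * edist x y `^ (- (n%:R + eps)) * G y `^ r.
  by rewrite !mulr_ge0 ?powR_ge0// indicE.
have mgr : mf (fun y => ((edist x y ^+ n)^-1 * G y) `^ r * \1_(O `&` E) y).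
  by apply: measurable_funM => //; exact: mpr.
have mw : mf (fun y => \1_O y * edist x y `^ (- (n%:R + eps)) * G y `^ r).
  by apply: measurable_funM; [exact: measurable_funM|exact: mpr].
rewrite -!integral_EFinZ ?mulr_ge0 ?powR_ge0//.
apply: le_integral_EFin.
- by move=> y; rewrite mulr_ge0 ?powR_ge0.
- exact: measurable_funM.
- exact: measurable_funM.
move=> y; have [hy|hy] := pselect ((O `&` E) y); last first.
  by rewrite [\1_(O `&` E) y]indicE memNset// !mulr0 mulr_ge0 ?mulr_ge0 ?powR_ge0.
have [Oy Ey] := hy; rewrite !indicE !mem_set// mulr1 mul1r.
have v2l : 2 * l <= edist x y := far_edist hx Oy.
have v0 : 0 < edist x y by apply: lt_le_trans v2l; rewrite mulr_gt0.
have Sv : S <= n.+1%:R * edist x y.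
  have h : n%:R * (2 * l) <= n%:R * edist x y by rewrite ler_wpM2l.
  rewrite -addn1 natrD mulrDl mul1r /S; move: Ey h => /andP[h1 _].
  by rewrite mulrCA; set a := n%:R * l in h1 *; lra.
rewrite [((edist x y ^+ n)^-1 * _) `^ r]powRM// -[edist x y ^+ n]powR_mulrn ?edist_ge0//.
rewrite -[(_ `^ _)^-1]powRN -powRrM !mulrA.
apply: ler_wpM2r; first exact: powR_ge0.
apply: (@le_trans _ _ ((thin_cst * l `^ 2^-1 * edist x y `^ (n%:R - 2^-1)) `^ (r - 1) *
    edist x y `^ (- n%:R * r))).
  apply: ler_wpM2r; first exact: powR_ge0.
  apply: ge0_ler_powR; rewrite ?nnegrE//; first exact: ltW.
    rewrite -thin_measure_le// !mulr_ge0 ?exprn_ge0 ?sqrtr_ge0// mulr_ge0//.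
    by rewrite mulr_ge0// ltW.
  rewrite -thin_measure_le//; apply: ler_pM.
  - by rewrite exprn_ge0// mulr_ge0.
  - by rewrite mulr_ge0 ?sqrtr_ge0.
  - apply: lerXn2r; last by rewrite ler_pM2l.
      by rewrite nnegrE mulr_ge0.
    by rewrite nnegrE !mulr_ge0// ltW.
  rewrite ler_pM2l//; apply: ler_wsqrtr; exact: ler_wpM2l.
have tc0 : 0 <= thin_cst.
  by rewrite /thin_cst !mulr_ge0 ?exprn_ge0 ?sqrtr_ge0 ?mulr_ge0.
rewrite [(thin_cst * _ * _) `^ _]powRM ?mulr_ge0 ?powR_ge0//.
rewrite [(thin_cst * _) `^ _]powRM ?powR_ge0// -!powRrM -!mulrA.
apply: ler_wpM2l; first exact: powR_ge0.
rewrite -powRD; last by rewrite (gt_eqF v0) implybT.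
rewrite le_eqVlt; apply/orP; left; apply/eqP.
congr (_ * _); congr powR; first by rewrite /eps mulrC.
by rewrite /eps; field.
Qed.

End thin_shell.

(** * Variation of the truncated integrals *)
Section oscillation.
Context {R : realType} {n : nat}.
Local Notation mu := (lebesgue_tuple R n).
Local Notation mf f := (measurable_fun setT (f : n.-tuple R -> R)).
Local Notation cmod := (@Normc.normc R).
Variables (omega : R -> R) (CK : R) (K : n.-tuple R -> n.-tuple R -> R[i]).
Hypotheses (womega : modulus_of_continuity omega) (CK0 : 0 < CK)
  (domega : (dini_norm omega < +oo)%E) (KK : CZ_kernel omega CK K) (n0 : (0 < n)%N).
Variables (q r : R).
Hypotheses (r1 : 1 < r) (rq : r <= q).
Implicit Types (c x y : n.-tuple R) (f g : n.-tuple R -> R[i]).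

Local Notation Ko := (offdiag K).
Local Notation Lr f := (\int[mu]_y (cmod (f y) `^ r)%:E < +oo)%E.

Lemma cmeasurable_cutoff (A : set (n.-tuple R)) f : measurable A -> cmeasurable f ->
  cmeasurable (cutoff A f).
Proof. by move=> mA hf; apply: cmeasurableM => //; exact: cmeasurable_indic. Qed.

Lemma cmod_cutoff (A : set (n.-tuple R)) f y : cmod (cutoff A f y) = cmod (f y) * \1_A y.
Proof. by rewrite /cutoff Normc.normcM cmod_indic. Qed.

Lemma Lr_cutoff (A : set (n.-tuple R)) f : measurable A -> cmeasurable f -> Lr f ->
  Lr (cutoff A f).
Proof.
move=> mA hf; apply: le_lt_trans.
have r0 : 0 < r by exact: lt_trans r1.
have mpr g : cmeasurable g -> mf (fun y => cmod (g y) `^ r).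
  by move=> /cmeasurable_normc mg; exact: (measurableT_comp (measurable_powR _)).
apply: le_integral_EFin.
- by move=> y; exact: powR_ge0.
- by apply: mpr; exact: cmeasurable_cutoff.
- exact: mpr.
move=> y; apply: ge0_ler_powR; rewrite ?nnegrE ?normc_ge0//; first exact: ltW.
rewrite cmod_cutoff -[leRHS]mulr1; apply: ler_wpM2l; first exact: normc_ge0.
by rewrite indicE; case: (_ \in _).
Qed.

Definition truncated_integrand f x (s : R) y : R[i] := Ko x y * f y * ((outside s x y)%:C)%C.

Lemma truncations_integrand f x (s : R) : 0 < s ->
  truncations K f x s = cintegral setT (truncated_integrand f x s).
Proof.
move=> s0; rewrite truncationsE//; congr cintegral; apply/funext => y.
by rewrite /truncated_integrand -outsideE -cindicE.
Qed.

Lemma cintegrable_integrand f x (s : R) : 0 < s -> cmeasurable f -> Lr f ->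
  cintegrable (truncated_integrand f x s).
Proof.
move=> s0 hf Lf.
have := cintegrable_truncation womega CK0 domega KK x n0 r1 s0 hf Lf.
rewrite (_ : (fun y => _) = truncated_integrand f x s)//; apply/funext => y.
by rewrite /truncated_integrand -outsideE -cindicE.
Qed.

Lemma cmod_shell (eta : nat -> R) x j y : nonincreasing_seq eta ->
  cmod ((outside (eta j) x y)%:C - (outside (eta j.+1) x y)%:C)%C = shell eta x j y.
Proof.
move=> etan; rewrite -rmorphB cmod_realE distrC ger0_norm//; exact: shell_ge0.
Qed.

(** The increments of the truncations are integrals over disjoint shells, so already
their sum is bounded. *)
Lemma variation_truncations_le f g x (phi : n.-tuple R -> R) (Z : R) :
  cmeasurable f -> Lr f -> cmeasurable g -> Lr g -> 0 <= Z -> mf phi ->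
  (forall y, cmod (Ko x y * (f y - g y)) <= phi y) ->
  (\int[mu]_y (phi y)%:E <= Z%:E)%E ->
  (variation_norm q (truncations K f x - truncations K g x)%R <= (8 * Z)%:E)%E.
Proof.
move=> hf Lf hg Lg Z0 mphi hphi phiZ.
have phi0 y : 0 <= phi y by apply: le_trans (hphi y); exact: normc_ge0.
rewrite -[Z]addr0; apply: (@variation_cintegral_le _ _ r q Z 0 _
  (fun s y => truncated_integrand f x s y - truncated_integrand g x s y)) => //; first exact: ltW.
  move=> s s0; have If := cintegrable_integrand x s0 hf Lf.
  have Ig := cintegrable_integrand x s0 hg Lg.
  by split; [exact: cintegrableB|rewrite cintegralB// -!truncations_integrand].
move=> eta eta0 etan.
exists (fun j y => shell eta x j y * phi y), (fun _ _ => 0); split.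
- by move=> j y; split => //; rewrite mulr_ge0//; exact: shell_ge0.
- by move=> j; split => //; apply: measurable_funM => //; exact: measurable_shell.
- move=> j y; rewrite addr0 /truncated_integrand.
  rewrite (_ : _ - _ = Ko x y * (f y - g y) *
      ((outside (eta j) x y)%:C - (outside (eta j.+1) x y)%:C)%C); last by ring.
  rewrite Normc.normcM cmod_shell// mulrC.
  by apply: ler_wpM2l => //; exact: shell_ge0.
- move=> N; rewrite -[Z]mul1r EFinM; apply: (@le_trans _ _ (1%:E * \int[mu]_y (phi y)%:E)%E).
    apply: sum_integral_le => // [j y|j|y]; [exact: shell_ge0|exact: measurable_shell|].
    exact: sum_shell_le1.
  by apply: lee_wpmul2l.
- move=> N; rewrite big1 ?lee_fin ?powR_ge0// => j _.
  by rewrite integral0_eq// poweR0r// gt_eqF// (lt_trans _ r1).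
Qed.

(** The weight [de] is meant to be the difference of the shells of index [j] around two
points of the cube; it lives on two thin annuli, to each of which [thin_shell_le] applies.
The right-hand side is linear in [de], hence summable over [j]. *)
Lemma thin_difference_le c x (l s s' : R) (de : n.-tuple R -> R) f :
  0 < l -> 0 < s -> 0 < s' -> box c l x -> cmeasurable f ->
  (forall y, 0 <= de y <= 1) -> mf de ->
  (forall y, de y != 0 -> (s - n%:R * l <= edist x y <= s + n%:R * l) ||
                          (s' - n%:R * l <= edist x y <= s' + n%:R * l)) ->
  ((\int[mu]_y (de y * (\1_(~` box c (5 * l)) y * cmod (Ko x y) * cmod (f y)))%:E) `^ r <=
   (CK `^ r * (2 `^ r * (2 * (thin_cst (R := R) (n := n) `^ (r - 1) * l `^ ((r - 1) / 2)))))%:E *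
   \int[mu]_y (de y * (\1_(~` box c (5 * l)) y *
     edist x y `^ (- (n%:R + (r - 1) / 2)) * cmod (f y) `^ r))%:E)%E.
Proof.
set O := ~` box c (5 * l); set eps := (r - 1) / 2; set th := _ * l `^ eps.
move=> l0 s0 s'0 hx hf de01 mde hde.
have r0 : 0 < r by exact: lt_trans r1.
have de0 y : 0 <= de y by case/andP: (de01 y).
have mcf := cmeasurable_normc hf.
have mO : measurable O by apply: measurableC; exact: measurable_box.
have mO1 : mf (\1_O) by exact: measurable_indic.
have mpow a := measurable_edist_powR x a.
have minv := measurable_edist_exprV x n.
have inv0 y : 0 <= (edist x y ^+ n)^-1 by rewrite invr_ge0 exprn_ge0// edist_ge0.
pose E (t : R) : set (n.-tuple R) :=
  [set y | (t - n%:R * l <= edist x y <= t + n%:R * l)%R].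
have mE t : measurable (E t).
  rewrite (_ : E t = setT `&` edist x @^-1` `[t - n%:R * l, t + n%:R * l]).
    exact: measurable_edist.
  by rewrite setTI; apply/seteqP; split => z /=; rewrite in_itv.
have mE1 t : mf (\1_(E t)) by exact: measurable_indic.
pose G y := de y * cmod (f y).
have G0 y : 0 <= G y by rewrite mulr_ge0// normc_ge0.
have mG : mf G by exact: measurable_funM.
pose H t y := (edist x y ^+ n)^-1 * \1_O y * G y * \1_(E t) y.
have H0 t y : 0 <= H t y by rewrite !mulr_ge0 ?normc_ge0// indicE.
have mH t : mf (H t).
  by do 3 (apply: measurable_funM => //).
have th0 : 0 <= th by rewrite mulr_ge0 ?powR_ge0.
have mKo : mf (fun y => cmod (Ko x y)).
  by apply: cmeasurable_normc; exact: (cmeasurable_offdiag womega CK0 domega KK).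
have mpr (u : n.-tuple R -> R) : mf u -> mf (fun y => u y `^ r).
  by move=> hu; exact: (measurableT_comp (measurable_powR _)).
set J := (\int[mu]_y (de y * (\1_O y *
   edist x y `^ (- (n%:R + eps)) * cmod (f y) `^ r))%:E)%E.
have HJ t : 0 < t -> ((\int[mu]_y (H t y)%:E) `^ r <= th%:E * J)%E.
  move=> t0; apply: le_trans (thin_shell_le n0 r1 l0 t0 hx G0 mG) _.
  apply: lee_wpmul2l => //; apply: le_integral_EFin.
  - by move=> y; rewrite !mulr_ge0 ?powR_ge0// indicE.
  - exact: (measurable_funM (measurable_funM mO1 (mpow _)) (mpr _ mG)).
  - exact: (measurable_funM mde (measurable_funM (measurable_funM mO1 (mpow _)) (mpr _ mcf))).
  move=> y; rewrite [leRHS]mulrCA; apply: ler_wpM2l.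
    by rewrite mulr_ge0 ?powR_ge0// indicE.
  rewrite powRM ?normc_ge0//; apply: ler_wpM2r; first exact: powR_ge0.
  have [->|dey] := eqVneq (de y) 0; first by rewrite powR0// gt_eqF.
  have d0 : 0 < de y by rewrite lt_neqAle eq_sym dey de0.
  have -> : de y `^ r = de y * de y `^ (r - 1).
    by rewrite -{2}[de y]powRr1// -powRD ?subrKC// (gt_eqF d0) implybT.
  rewrite -[leRHS]mulr1; apply: ler_wpM2l => //.
  have : de y `^ (r - 1) <= 1 `^ (r - 1).
    apply: ge0_ler_powR; rewrite ?nnegrE ?subr_ge0//; first exact: ltW.
    by case/andP: (de01 y).
  by rewrite powR1.
have HE : (\int[mu]_y (de y * (\1_O y * cmod (Ko x y) * cmod (f y)))%:E <=
    CK%:E * (\int[mu]_y (H s y)%:E + \int[mu]_y (H s' y)%:E))%E.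
  rewrite -integral_EFinD// -integral_EFinZ; last 3 first.
  - exact: ltW.
  - by move=> y; rewrite addr_ge0.
  - exact: measurable_funD.
  apply: le_integral_EFin.
  - by move=> y; rewrite !mulr_ge0 ?normc_ge0// indicE.
  - by do 3 (apply: measurable_funM => //).
  - by apply: measurable_funM => //; exact: measurable_funD.
  move=> y; have [dey|dey] := eqVneq (de y) 0.
    by rewrite dey mul0r mulr_ge0 ?addr_ge0// ltW.
  have Hle : H s y + H s' y >= (edist x y ^+ n)^-1 * \1_O y * G y.
    rewrite /H -mulrDr -[leLHS]mulr1; apply: ler_wpM2l.
      by rewrite !mulr_ge0 ?normc_ge0// indicE.
    rewrite !indicE; case/orP: (hde y dey) => hy.
      by rewrite (@mem_set _ (E s))// lerDl.
    by rewrite (@mem_set _ (E s'))// lerDr.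
  apply: le_trans (ler_wpM2l (ltW CK0) Hle).
  rewrite (_ : CK * _ = de y * (\1_O y * (CK / edist x y ^+ n) * cmod (f y))); last first.
    by rewrite /G; ring.
  apply: ler_wpM2l => //; apply: ler_wpM2r; first exact: normc_ge0.
  by apply: ler_wpM2l; [rewrite indicE|exact: (offdiag_size CK0 KK)].
have I0 t : (0 <= \int[mu]_y (H t y)%:E)%E.
  by apply: integral_ge0 => y _; rewrite lee_fin.
have IL : (0 <= \int[mu]_y (de y * (\1_O y * cmod (Ko x y) * cmod (f y)))%:E)%E.
  by apply: integral_ge0 => y _; rewrite lee_fin !mulr_ge0 ?normc_ge0// indicE.
have CKe : (0 <= CK%:E :> \bar R)%E by rewrite lee_fin ltW.
apply: (@le_trans _ _ ((CK%:E * (\int[mu]_y (H s y)%:E + \int[mu]_y (H s' y)%:E)) `^ r)%E).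
  apply: gt0_ler_poweR => //; first exact: ltW.
    by rewrite in_itv/= leey andbT.
  by rewrite in_itv/= leey andbT mule_ge0// adde_ge0.
rewrite (poweRM r CKe (adde_ge0 (I0 s) (I0 s'))) poweR_EFin EFinM -muleA.
apply: lee_wpmul2l; first by rewrite lee_fin powR_ge0.
apply: le_trans (poweRD_le r0 (I0 s) (I0 s')) _.
rewrite EFinM -muleA; apply: lee_wpmul2l; first by rewrite lee_fin powR_ge0.
rewrite mulr_natl mulr2n EFinD ge0_muleDl ?lee_fin//.
by apply: leeD; exact: HJ.
Qed.

(** The key splitting: with [h] the part of [f] outside of the fivefold cube,
[K(x) h 1_(shell of x) - K(x') h 1_(shell of x')] is the sum of
[(K(x) - K(x')) h 1_(shell of x)] and of
[K(x') h (1_(shell of x) - 1_(shell of x'))]. The first terms are summable over the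
shells, with total [B]; the second ones are summable to the power [r <= q], by
[thin_difference_le] and because the differences of shells overlap at most twice. *)
Lemma variation_oscillation_le c x x' (l : R) f (B C : R) :
  0 < l -> box c l x -> box c l x' -> cmeasurable f -> Lr f -> 0 <= B -> 0 <= C ->
  let O := ~` box c (5 * l) in
  (\int[mu]_y (\1_O y * cmod (Ko x y - Ko x' y) * cmod (f y))%:E <= B%:E)%E ->
  ((CK `^ r * (2 `^ r * (2 * (thin_cst (R := R) (n := n) `^ (r - 1) *
        l `^ ((r - 1) / 2)))))%:E *
   (2%:E * \int[mu]_y (\1_O y * edist x' y `^ (- (n%:R + (r - 1) / 2)) *
     cmod (f y) `^ r)%:E) <= (C `^ r)%:E)%E ->
  (variation_norm q
    ((truncations K f x - truncations K (cutoff (box c (5 * l)) f) x) -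
     (truncations K f x' - truncations K (cutoff (box c (5 * l)) f) x'))%R
   <= (8 * (B + C))%:E)%E.
Proof.
move=> l0 hx hx' hf Lf B0 C0 O hB hC.
have r0 : 0 < r by exact: lt_trans r1.
have mA : measurable (box c (5 * l)) by exact: measurable_box.
have mO : measurable O by exact: measurableC.
have mO1 : mf (\1_O) by exact: measurable_indic.
have mcf := cmeasurable_normc hf.
have hfA := cmeasurable_cutoff mA hf.
have LfA := Lr_cutoff mA hf Lf.
have mK z : cmeasurable (Ko z) by exact: (cmeasurable_offdiag womega CK0 domega KK).
have mKB : mf (fun y => cmod (Ko x y - Ko x' y)).
  by apply: cmeasurable_normc; exact: cmeasurableB.
have mKx' : mf (fun y => cmod (Ko x' y)) by exact: cmeasurable_normc.
have mgB : mf (fun y => \1_O y * cmod (Ko x y - Ko x' y) * cmod (f y)).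
  by do 2 (apply: measurable_funM => //).
pose fA := cutoff (box c (5 * l)) f.
apply: (@variation_cintegral_le _ _ r q B C _
  (fun s y => (truncated_integrand f x s y - truncated_integrand fA x s y) -
     (truncated_integrand f x' s y - truncated_integrand fA x' s y))) => //.
- exact: ltW.
- move=> s s0.
  have If z := cintegrable_integrand z s0 hf Lf; have Ig z := cintegrable_integrand z s0 hfA LfA.
  have IB z := cintegrableB (If z) (Ig z).
  split; first exact: cintegrableB.
  by rewrite cintegralB// !cintegralB// -!truncations_integrand.
move=> eta eta0 etan.
pose de j y := `|shell eta x j y - shell eta x' j y|.
have de01 j y : 0 <= de j y <= 1.
  rewrite normr_ge0/= ler_norml.
  have := shell_ge0 x j y etan; have := shell_ge0 x' j y etan.
  have := shell_le1 eta x j y; have := shell_le1 eta x' j y.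
  by move=> ? ? ? ?; apply/andP; split; lra.
have de0 j y : 0 <= de j y by exact: normr_ge0.
have mde j : mf (de j).
  by apply: measurableT_comp => //; apply: measurable_funB; exact: measurable_shell.
exists (fun j y => shell eta x j y * (\1_O y * cmod (Ko x y - Ko x' y) * cmod (f y))).
exists (fun j y => de j y * (\1_O y * cmod (Ko x' y) * cmod (f y))).
have gB0 y : 0 <= \1_O y * cmod (Ko x y - Ko x' y) * cmod (f y).
  by rewrite !mulr_ge0 ?normc_ge0// indicE.
have gC0 y : 0 <= \1_O y * cmod (Ko x' y) * cmod (f y).
  by rewrite !mulr_ge0 ?normc_ge0// indicE.
split.
- by move=> j y; split; rewrite mulr_ge0//; exact: shell_ge0.
- move=> j; split; first by apply: measurable_funM => //; exact: measurable_shell.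
  by do 3 (apply: measurable_funM => //).
- move=> j y; rewrite /truncated_integrand.
  set ex := ((outside (eta j) x y)%:C - (outside (eta j.+1) x y)%:C)%C.
  set ex' := ((outside (eta j) x' y)%:C - (outside (eta j.+1) x' y)%:C)%C.
  rewrite (_ : _ - _ = (f y - fA y) * (Ko x y - Ko x' y) * ex +
      (f y - fA y) * Ko x' y * (ex - ex')); last by rewrite /ex /ex'; ring.
  apply: le_trans (normcD_le _ _) _; rewrite !Normc.normcM.
  have -> : cmod (f y - fA y) = \1_O y * cmod (f y).
    rewrite (_ : f y - fA y = cutoff O f y); first by rewrite cmod_cutoff mulrC.
    rewrite /fA /cutoff /O !cindicE !indicE in_setC.
    by case: (_ \in _); rewrite /= ?mulr1 ?mulr0 ?subrr ?subr0.
  rewrite cmod_shell//.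
  have -> : cmod (ex - ex') = de j y.
    by rewrite /ex /ex' -!rmorphB cmod_realE /de -normrN; congr `| _ |; rewrite /shell; ring.
  by rewrite le_eqVlt; apply/orP; left; apply/eqP; ring.
- move=> N; rewrite -[B]mul1r EFinM; apply: (@le_trans _ _ (1%:E * \int[mu]_y
      (\1_O y * cmod (Ko x y - Ko x' y) * cmod (f y))%:E)%E); last exact: lee_wpmul2l.
  apply: sum_integral_le => // [j y|j|y]; [exact: shell_ge0|exact: measurable_shell|].
  exact: sum_shell_le1.
move=> N; apply: le_trans hC.
set P := (CK `^ r * _).
have P0 : 0 <= P by rewrite !mulr_ge0 ?powR_ge0.
set g := (fun y => _ : R) in mgB gB0 *.
pose gX y := \1_O y * edist x' y `^ (- (n%:R + (r - 1) / 2)) * cmod (f y) `^ r.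
have gX0 y : 0 <= gX y by rewrite !mulr_ge0 ?powR_ge0// indicE.
have mgX : mf gX.
  apply: measurable_funM; last exact: (measurableT_comp (measurable_powR _)).
  apply: measurable_funM => //; exact: measurable_edist_powR.
apply: (@le_trans _ _ (\sum_(j < N) P%:E * \int[mu]_y (de j y * gX y)%:E)%E).
  apply: lee_sum => j _.
  apply: (@thin_difference_le c x' l (eta j) (eta j.+1) (de j) f) => //.
  move=> y; rewrite normr_eq0 subr_eq0; apply: shell_sub.
  by apply: edist_le_box hx hx'; exact: ltW.
rewrite -ge0_sume_distrr; last first.
  by move=> j _; apply: integral_ge0 => y _; rewrite lee_fin mulr_ge0.
apply: lee_wpmul2l => //; apply: sum_integral_le => // y.
rewrite (_ : 2 = 1 + 1)//; apply: (@le_trans _ _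
  (\sum_(j < N) (shell eta x j y + shell eta x' j y))).
  apply: ler_sum => j _; apply: le_trans (ler_normB _ _) _.
  by rewrite !ger0_norm//; exact: shell_ge0.
by rewrite big_split/=; apply: lerD; exact: sum_shell_le1.
Qed.

End oscillation.

(** * Regularity of the kernel, summed over dyadic scales *)
Section kernel_difference.
Context {R : realType} {n : nat}.
Local Notation mu := (lebesgue_tuple R n).
Local Notation mf f := (measurable_fun setT (f : n.-tuple R -> R)).
Local Notation cmod := (@Normc.normc R).
Variables (omega : R -> R) (CK : R) (K : n.-tuple R -> n.-tuple R -> R[i]).
Hypotheses (womega : modulus_of_continuity omega) (CK0 : 0 < CK)
  (domega : (dini_norm omega < +oo)%E) (KK : CZ_kernel omega CK K).
Implicit Types (c x y : n.-tuple R) (f : n.-tuple R -> R[i]).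
Local Notation Ko := (offdiag K).

(** The first term comes from the regularity of the kernel, as
[edist x x' / edist x y <= 5 * n * 2 ^- k] at the scale [k]. The second one comes from
the size of the kernel, at the finitely many scales where [x] and [x'] are too far apart, compared
with [y], for the regularity to apply. *)
Definition dyadic_weight (k : nat) : R :=
  if k is 0%N then 0
  else (5 * n)%:R * omega (2 ^- k) + 2 * (k < 10 * n)%N%:R.

Lemma dyadic_weight_ge0 k : 0 <= dyadic_weight k.
Proof.
case: k => // k; rewrite addr_ge0 ?mulr_ge0// (modulus_ge0 womega)//.
Qed.

Lemma sum_dyadic_weight_le N :
  \sum_(k < N) dyadic_weight k <= 20 * n%:R * (1 + fine (dini_norm omega)).
Proof.
have D0 : 0 <= 2 * fine (dini_norm omega).
  by have := dini_sum_fin womega 0 domega; rewrite big_ord0.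
have {}D0 : 0 <= fine (dini_norm omega) by rewrite pmulr_rge0 in D0.
case: N => [|N]; first by rewrite big_ord0 !mulr_ge0// addr_ge0.
rewrite big_ord_recl/= add0r big_split/= -!big_distrr/=.
have H1 := dini_sum_fin womega N domega.
have H2 : \sum_(k < N) ((bump 0 k < 10 * n)%N%:R : R) <= (10 * n)%:R.
  apply: (@le_trans _ _ (minn N (10 * n))%:R); last by rewrite ler_nat geq_minr.
  elim: N {H1} => [|N IH]; first by rewrite big_ord0.
  rewrite big_ord_recr/=; apply: le_trans (lerD IH (lexx _)) _.
  by rewrite -natrD ler_nat /bump/=; case: ltnP; lia.
apply: (@le_trans _ _ ((5 * n)%:R * (2 * fine (dini_norm omega)) + 2 * (10 * n)%:R)).
  apply: lerD; first exact: ler_wpM2l.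
  by apply: ler_wpM2l.
by rewrite !natrM; have : 0 <= n%:R * fine (dini_norm omega); [rewrite mulr_ge0|lra].
Qed.

Lemma kernel_difference_pointwise_le c x x' y (l : R) k :
  0 < l -> box c l x -> box c l x' -> ~ box c (5 * l) y -> (0 < k)%N ->
  2 ^+ k * l <= 5 * edist x y -> 2 ^+ k * l <= 5 * edist x' y ->
  cmod (Ko x y - Ko x' y) <= CK * 5 ^+ n / (2 ^+ k * l) ^+ n * dyadic_weight k.
Proof.
move=> l0 hx hx' hy k0 kx kx'.
have p0 : 0 < 2 ^+ k * l by rewrite mulr_gt0// exprn_gt0.
have far z : box c l z -> 0 < edist z y.
  by move=> hz; apply: lt_le_trans (far_edist hz hy); rewrite mulr_gt0.
have v0 := far x hx; have v'0 := far x' hx'.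
have ne z : 0 < edist z y -> z != y by apply: contraTneq => ->; rewrite edistxx ltxx.
have size z : 0 < edist z y -> 2 ^+ k * l <= 5 * edist z y ->
    CK / edist z y ^+ n <= CK * 5 ^+ n / (2 ^+ k * l) ^+ n.
  move=> z0 hz; rewrite -mulrA ler_pM2l// -[5 ^+ n]invrK -invfM.
  rewrite lef_pV2 ?posrE ?mulr_gt0 ?invr_gt0 ?exprn_gt0//.
  rewrite ler_pdivrMl ?exprn_gt0// -exprMn.
  apply: lerXn2r => //; rewrite nnegrE; first exact: ltW.
  by rewrite mulr_ge0// ltW.
have dxx : edist x x' <= n%:R * l by apply: edist_le_box hx hx'; exact: ltW.
have A0 : 0 <= CK * 5 ^+ n / (2 ^+ k * l) ^+ n.
  by rewrite divr_ge0 ?mulr_ge0 ?exprn_ge0 ?(ltW CK0) ?(ltW p0).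
have om0 : 0 <= omega (2 ^- k) by rewrite (modulus_ge0 womega)// invr_ge0 exprn_ge0.
case: k k0 p0 kx kx' size A0 om0 => // k _ p0 kx kx' size A0 om0.
rewrite /dyadic_weight; have [d2|d2] := leP (edist x x') (2^-1 * edist x y).
  rewrite /offdiag !ifN ?ne//; apply: le_trans (CZ_kernel_regl KK (ne x v0) d2) _.
  apply: ler_pM => //.
  - by rewrite divr_ge0 ?exprn_ge0 ?(ltW CK0) ?(ltW v0).
  - by rewrite (modulus_ge0 womega)// divr_ge0 ?edist_ge0.
  - exact: size.
  apply: (@le_trans _ _ ((5 * n)%:R * omega (2 ^- k.+1))); last by rewrite lerDl mulr_ge0.
  apply: le_trans (modulus_natM womega _ _); last by rewrite invr_ge0 exprn_ge0.
  apply: (modulus_le womega); first by rewrite divr_ge0 ?edist_ge0.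
  rewrite ler_pdivrMr// mulrAC ler_pdivlMr ?exprn_gt0//.
  apply: (@le_trans _ _ (n%:R * l * 2 ^+ k.+1)).
    by apply: ler_wpM2r => //; rewrite exprn_ge0.
  rewrite natrM -mulrA [l * _]mulrC [5 * _]mulrC -mulrA.
  by apply: ler_wpM2l.
have kn : (k.+1 < 10 * n)%N.
  apply: ltn_trans (ltn_expl k.+1 (ltnSn 1)) _.
  rewrite -(ltr_nat R) natrX natrM -(ltr_pM2r l0).
  have h1 : edist x y < 2 * (n%:R * l) by lra.
  apply: le_lt_trans kx _; rewrite (_ : 10 * n%:R * l = 5 * (2 * (n%:R * l))); last by ring.
  by rewrite ltr_pM2l.
rewrite kn mulr1; apply: le_trans (normcB_le _ _) _.
apply: (@le_trans _ _ (CK / edist x y ^+ n + CK / edist x' y ^+ n)).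
  by apply: lerD; exact: (offdiag_size CK0 KK).
apply: (@le_trans _ _ (CK * 5 ^+ n / (2 ^+ k.+1 * l) ^+ n * 2)).
  by rewrite mulr_natr mulr2n; apply: lerD; exact: size.
by apply: ler_wpM2l => //; rewrite lerDr mulr_ge0.
Qed.

Lemma kernel_difference_le (r M l : R) c x x' f :
  1 < r -> 0 < M -> 0 < l -> box c l x -> box c l x' -> cmeasurable f ->
  (forall k, (average r (box c (2 ^+ k * l)) f <= M%:E)%E) ->
  (\int[mu]_y (\1_(~` box c (5 * l)) y * cmod (Ko x y - Ko x' y) * cmod (f y))%:E <=
   (CK * M * (40 * n%:R * 5 ^+ n) * (1 + fine (dini_norm omega)))%:E)%E.
Proof.
move=> r1 M0 l0 hx hx' hf hM; set O := ~` _.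
have p0 k : 0 < 2 ^+ k * l by rewrite mulr_gt0// exprn_gt0.
have mO : measurable O by apply: measurableC; exact: measurable_box.
have mK z : cmeasurable (Ko z) by exact: (cmeasurable_offdiag womega CK0 domega KK).
have mKB : mf (fun y => cmod (Ko x y - Ko x' y)).
  by apply: cmeasurable_normc; exact: cmeasurableB.
pose w k := CK * 5 ^+ n / (2 ^+ k * l) ^+ n * dyadic_weight k.
rewrite (_ : CK * M * _ * _ = 2 * M * (CK * 5 ^+ n *
  (20 * n%:R * (1 + fine (dini_norm omega))))); last by ring.
apply: (@dyadic_integral_le _ _ c l (fun y => cmod (f y)) _ w).
- exact: ltW.
- by move=> y; exact: normc_ge0.
- exact: cmeasurable_normc.
- by move=> y; rewrite mulr_ge0 ?normc_ge0// indicE.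
- by apply: measurable_funM => //; exact: measurable_indic.
- move=> k; rewrite mulr_ge0 ?dyadic_weight_ge0// divr_ge0 ?mulr_ge0 ?exprn_ge0 ?(ltW CK0)//.
  exact: ltW.
- by rewrite mulr_ge0// ltW.
- by move=> k; exact: (integral_le_average r1 (p0 k) M0 hf (hM k)).
- move=> y; rewrite indicE; case: (boolP (y \in O)); last by rewrite mul0r eqxx.
  rewrite inE mul1r => Oy _; have [k [k0 hk hkz]] := far_dyadic_scale l0 Oy.
  exists k => //.
  exact: (kernel_difference_pointwise_le l0 hx hx' Oy k0 (hkz _ hx) (hkz _ hx')).
- move=> N; rewrite (eq_bigr (fun k : 'I_N => CK * 5 ^+ n * dyadic_weight k)); last first.
    by move=> k _; rewrite /w; field; rewrite expf_neq0// gt_eqF.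
  rewrite -big_distrr/=; apply: ler_wpM2l; last exact: sum_dyadic_weight_le.
  by rewrite mulr_ge0 ?exprn_ge0// ltW.
Qed.

End kernel_difference.

(** * Bounded oscillation *)
Unset Implicit Arguments.

Theorem theorem2p31 (R : realType) (n : nat) (hn : (0 < n)%N)
    (q : R) (hq : 2 < q) (r : R) (hr : 1 < r) (hrq : r <= q) :
  exists2 C : R, 0 < C &
  forall CK : R, 0 < CK ->
  exists2 C' : R, 0 < C' &
  forall (omega : R -> R) (K : n.-tuple R -> n.-tuple R -> R[i])
      (T : (n.-tuple R -> R[i]) -> n.-tuple R -> R[i]),
    modulus_of_continuity omega ->
    (dini_norm omega < +oo)%E ->
    CZ_operator omega CK K T ->
    exists c1 c2 : R,
      [/\ bounded_oscillation (@cube_set R n) (@cube_star R n) r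
             (variation_norm q) (truncations K) c1 c2,
          c1 <= C * CK
        & (c2%:E <= C'%:E * (1 + dini_norm omega))%E].
Proof.
have r0 : 0 < r by exact: lt_trans hr.
have n0 : 0 < n%:R :> R by rewrite ltr0n.
pose eps := (r - 1) / 2.
have e0 : 0 < eps by rewrite divr_gt0// subr_gt0.
pose tau : R := 5 `^ (n%:R + eps) * (1 - 2 `^ (- eps))^-1.
pose th : R := @thin_cst R n `^ (r - 1).
(* The r-th root of all the factors collected in [variation_oscillation_le] and
   [tail_integral_le], where the powers of the side [l] cancel. *)
pose Gam : R := (2 `^ r * (2 * th) * (2 * tau)) `^ r^-1.
have tau0 : 0 <= tau.
  rewrite mulr_ge0 ?powR_ge0//.
  by apply: le_trans (geometric_le 0 e0); rewrite big_ord0.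
have Gam0 : 0 <= Gam by exact: powR_ge0.
pose beta : R := 40 * n%:R * 5 ^+ n.
have beta0 : 0 < beta by rewrite !mulr_gt0 ?exprn_gt0.
exists (16 * 5 ^+ n); first by rewrite mulr_gt0 ?exprn_gt0.
move=> CK CK0; exists (8 * CK * (beta + Gam)).
  by rewrite !mulr_gt0// ltr_pwDl.
move=> omega K T womega domega HT.
have KK := CZ_operator_kernel HT.
pose D := fine (dini_norm omega).
have D0 : 0 <= D.
  have := dini_sum_fin womega 0 domega; rewrite big_ord0.
  by rewrite pmulr_rge0.
have DE : dini_norm omega = D%:E.
  rewrite fineK// ge0_fin_numE//; apply: integral_ge0 => t.
  rewrite /= in_itv/= => /andP[t0 _].
  by rewrite lee_fin divr_ge0 ?(modulus_ge0 womega)// ltW.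
have D1 : 0 < 1 + D by rewrite ltr_pwDl.
exists (16 * 5 ^+ n * CK), (8 * CK * (beta + Gam) * (1 + D)).
split; last 2 first.
- exact: lexx.
- by rewrite DE -EFinD -EFinM.
split.
- by rewrite !mulr_gt0 ?exprn_gt0.
- by rewrite !mulr_gt0// ltr_pwDl.
- move=> Q0; set c := cube_center Q0; set l := cube_side Q0.
  have l0 : 0 < l := cube_side_gt0 Q0.
  have l20 : 0 < 2 * l by rewrite mulr_gt0.
  (* The doubled cube is a proper enlargement, and the points of its dilate which
     count are at distance at least [2 * l] from the original cube. *)
  exists (Cube c l20); split.
    split; first by apply: (@subset_box _ _ c l (2 * l)); lra.
    move=> sub.
    pose z : n.-tuple R := [tuple tnth c i + l | i < n].
    have /sub/(_ (Ordinal hn)) : cube_set (Cube c l20) z.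
      by move=> i; rewrite tnth_mktuple/= addrAC subrr add0r gtr0_norm//; lra.
    by rewrite tnth_mktuple/= addrAC subrr add0r gtr0_norm// -/l; lra.
  move=> f [hf Lf'].
  have Lf := cLp_integral r0 (conj hf Lf').
  apply: lee_forall_gt; [by rewrite !mulr_gt0 ?exprn_gt0|exact: average_ge0|] => M HM.
  have M0 : 0 < M by rewrite -lte_fin; apply: le_lt_trans HM; exact: average_ge0.
  apply: ge_ereal_sup => _ [x hx <-].
  have mA : measurable (cube_star (Cube c l20)) by exact: (measurable_box c (5 * (2 * l))).
  have mA0 : measurable (cube_star Q0) by exact: (measurable_box c (5 * l)).
  have L10 : 0 < 5 * (2 * l) by rewrite mulr_gt0.
  (* 8 from the variation, 2 from the average, and [5 ^+ n] is the ratio of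
     [(10 * l) ^+ n] and [(2 * l) ^+ n]. *)
  rewrite (_ : 16 * 5 ^+ n * CK * M = 8 * (CK / (2 * l) ^+ n * (2 * M * (5 * (2 * l)) ^+ n)));
    last by rewrite [(5 * _) ^+ n]exprMn; field; rewrite expf_neq0// gt_eqF.
  apply: (variation_truncations_le womega CK0 domega KK hn hr hrq
    (phi := fun y => CK / (2 * l) ^+ n * (Normc.normc (f y) * \1_(box c (5 * (2 * l))) y))).
  - exact: cmeasurable_cutoff.
  - exact: Lr_cutoff.
  - exact: cmeasurable_cutoff.
  - exact: Lr_cutoff.
  - by apply: ltW; rewrite mulr_gt0 ?divr_gt0 ?mulr_gt0 ?exprn_gt0.
  - apply: measurable_funM => //; apply: measurable_funM; first exact: cmeasurable_normc.
    by apply: measurable_indic; exact: measurable_box.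
  - move=> y.
    have phi0 : 0 <= CK / (2 * l) ^+ n * (Normc.normc (f y) * \1_(box c (5 * (2 * l))) y).
      apply: mulr_ge0; last by rewrite mulr_ge0 ?normc_ge0// indicE.
      by apply: ltW; rewrite divr_gt0 ?exprn_gt0.
    have [yA0|yA0] := pselect (cube_star Q0 y).
      have yA : cube_star (Cube c l20) y.
        by apply: (@subset_box _ _ c (5 * l) (5 * (2 * l))) yA0; lra.
      rewrite (_ : cutoff _ f y - cutoff _ f y = 0) ?mulr0 ?Normc.normc0//.
      by rewrite /cutoff !indicE !mem_set// subrr.
    rewrite Normc.normcM; apply: ler_pM; rewrite ?normc_ge0//.
      have v := far_edist hx yA0.
      apply: le_trans (offdiag_size CK0 KK x y) _.
      rewrite ler_pM2l// lef_pV2 ?posrE ?exprn_gt0//; last exact: lt_le_trans v.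
      by apply: lerXn2r; rewrite ?nnegrE ?edist_ge0// ltW.
    by rewrite /cutoff [in X in _ - X]indicE (memNset yA0) mulr0 subr0 Normc.normcM cmod_indic.
  - rewrite integral_EFinZ; last 3 first.
    + by apply: ltW; rewrite divr_gt0 ?exprn_gt0.
    + by move=> y; rewrite mulr_ge0 ?normc_ge0// indicE.
    + apply: measurable_funM; first exact: cmeasurable_normc.
      by apply: measurable_indic; exact: measurable_box.
    rewrite [leRHS]EFinM; apply: lee_wpmul2l.
      by rewrite lee_fin; apply: ltW; rewrite divr_gt0 ?exprn_gt0.
    by apply: (integral_le_average hr L10 M0 hf); exact: ltW.
move=> Q f [hf Lf'].
have Lf := cLp_integral r0 (conj hf Lf').
set c := cube_center Q; set l := cube_side Q.
have l0 : 0 < l := cube_side_gt0 Q.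
have p0 k : 0 < 2 ^+ k * l :> R by rewrite mulr_gt0 ?exprn_gt0.
have sup_ge k : (average r (box c (2 ^+ k * l)) f <= sup_average (@cube_set R n) r Q f)%E.
  apply: ereal_sup_ubound; exists (Cube c (p0 k)) => //.
  by apply: (@subset_box _ _ c l); rewrite ler_peMl ?(ltW l0)// exprn_ege1// ler1n.
have sup0 : (0 <= sup_average (@cube_set R n) r Q f)%E.
  by apply: le_trans (sup_ge 0%N); exact: average_ge0.
apply: lee_forall_gt => //; first by rewrite !mulr_gt0// ltr_pwDl.
move=> M HM.
have M0 : 0 < M by rewrite -lte_fin; apply: le_lt_trans HM.
have hM k : (average r (box c (2 ^+ k * l)) f <= M%:E)%E.
  by apply: le_trans (sup_ge k) _; exact: ltW.
apply: ge_ereal_sup => _ [x hx [x' hx' <-]].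
apply: (@le_trans _ _ (8 * (CK * M * beta * (1 + D) + CK * M * Gam))%:E); last first.
  have : 0 <= CK * M * Gam * D.
    by rewrite !mulr_ge0// ltW.
  by rewrite lee_fin; lra.
apply: (variation_oscillation_le womega CK0 domega KK hn hr hrq (c := c) (l := l)) => //.
- by rewrite !mulr_ge0// ltW.
- by rewrite !mulr_ge0// ltW.
- exact: (kernel_difference_le womega CK0 domega KK hr M0 l0 hx hx' hf hM).
have mO : measurable (~` box c (5 * l)) by apply: measurableC; exact: measurable_box.
have := @tail_integral_le R n c x' l (~` box c (5 * l))
  (fun y => Normc.normc (f y) `^ r) (M `^ r) eps l0 e0 (powR_ge0 _ _)
  (fun y => powR_ge0 _ _) _ mO.
move=> /(_ (measurableT_comp (measurable_powR _) (cmeasurable_normc hf))).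
move=> /(_ (fun k => integral_powR_le_average r0 (p0 k) (ltW M0) hf (hM k))).
have hO y : (~` box c (5 * l)) y ->
    exists2 k, box c (2 ^+ k * l) y & 2 ^+ k * l <= 5 * edist x' y.
  by move=> Oy; have [k [_ hk hkz]] := far_dyadic_scale l0 Oy; exists k => //; exact: hkz.
move=> /(_ hO) H.
set P := (CK `^ r * _).
have P0 : 0 <= P by rewrite !mulr_ge0 ?powR_ge0.
apply: (@le_trans _ _ (P%:E * (2%:E * (M `^ r * (tau * l `^ (- eps)))%:E))%E).
  apply: lee_wpmul2l; first by rewrite lee_fin.
  exact: lee_wpmul2l.
rewrite -!EFinM lee_fin powRM ?(mulr_ge0 (ltW CK0) (ltW M0))// powRM ?(ltW CK0) ?(ltW M0)//.
have -> : Gam `^ r = 2 `^ r * (2 * th) * (2 * tau).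
  rewrite /Gam -powRrM mulVf ?gt_eqF// powRr1//.
  by apply: mulr_ge0; [rewrite !mulr_ge0 ?powR_ge0|rewrite mulr_ge0].
have ll : l `^ eps * l `^ (- eps) = 1.
  by rewrite -powRD ?subrr ?powRr0// (gt_eqF l0) implybT.
rewrite le_eqVlt; apply/orP; left; apply/eqP.
rewrite /P -/eps -/th -[RHS]mulr1 -ll; ring.
Qed.
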